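(* Let $(\Omega,\alpha)$ be a measure space such that $\alpha(\Omega)=a$ is finite and positive, and let $k$ be a positive integer. Let $X\sim\mathcal{D}(\alpha)$ be a Dirichlet process on $\Omega$, let $B\sim\mathcal{B}_k(\alpha)$ be a quasi Bernoulli process on $\Omega$, and let $Y\sim\beta(k,a)$ be a real random variable, with $X$, $B$, $Y$ independent. Then $$X\sim(1-Y)X+YB .$$
   Context: $U\sim V$ means equality in distribution; for random probabilities on $\Omega$ this means that the vectors of values on any finite measurable partition of $\Omega$ have the same law. For $p,q>0$, $\beta(p,q)$ is the law on $(0,1)$ with density $\frac{\Gamma(p+q)}{\Gamma(p)\Gamma(q)}x^{p-1}(1-x)^{q-1}$. $\mathbb{N}=\{0,1,2,\ldots\}$; $(c)_0=1$, $(c)_{n+1}=(c)_n(c+n)$. $E_{d+1}$ is the set of $\lambda\in\mathbb{R}^{d+1}$ with $\lambda_i\ge0$ and $\lambda_0+\cdots+\lambda_d=1$; its vertices are the natural basis vectors $e_0,\ldots,e_d$. For positive $a_0,\ldots,a_d$, the Dirichlet distribution $\mathcal{D}(a_0,\ldots,a_d)$ is the law on $E_{d+1}$ of $(X_0,\ldots,X_d)$ with $X_0=1-X_1-\cdots-X_d$ such that $(X_1,\ldots,X_d)$ has density $\frac{\Gamma(a_0+\cdots+a_d)}{\Gamma(a_0)\cdots\Gamma(a_d)}(1-x_1-\cdots-x_d)^{a_0-1}x_1^{a_1-1}\cdots x_d^{a_d-1}$ on the set where $x_1,\ldots,x_d>0$ and $x_1+\cdots+x_d<1$. If $b_0,\ldots,b_d\ge0$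 are not all zero and $T=\{i: b_i>0\}$, then $\mathcal{D}(b_0,\ldots,b_d)$ denotes the Dirichlet distribution with parameters $(b_i)_{i\in T}$ concentrated on the convex hull of $(e_i)_{i\in T}$; if $T=\{i_0\}$ it is $\delta_{e_{i_0}}$. The quasi Bernoulli distribution of order $k$ is $$\mathcal{B}_k(a_0,\ldots,a_d)=\frac{k!}{(a)_k}\sum_{(b_0,\ldots,b_d)\in\mathbb{N}^{d+1};\ b_0+\cdots+b_d=k}\ \prod_{i=0}^d\frac{(a_i)_{b_i}}{b_i!}\ \mathcal{D}(b_0,\ldots,b_d),\qquad a=a_0+\cdots+a_d>0$$ (the same formula being used when some $a_i=0$). A Dirichlet process $P\sim\mathcal{D}(\alpha)$ is a random probability on $\Omega$ such that for any measurable partition $(A_0,\ldots,A_d)$ of $\Omega$, $(P(A_0),\ldots,P(A_d))\sim\mathcal{D}(\alpha(A_0),\ldots,\alpha(A_d))$. A quasi Bernoulli process $P\sim\mathcal{B}_k(\alpha)$ is a random probability on $\Omega$ such that for any measurable partition $(A_0,\ldots,A_d)$ of $\Omega$, $(P(A_0),\ldots,P(A_d))\sim\mathcal{B}_k(\alpha(A_0),\ldots,\alpha(A_d))$. *)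

(* Defs.v *)
From HB Require Import structures.
From mathcomp Require Import all_boot all_order all_algebra.
From mathcomp Require Import all_classical all_reals all_analysis.

Set Implicit Arguments.
Unset Strict Implicit.
Unset Printing Implicit Defensive.

Import Order.TTheory GRing.Theory Num.Theory.
Import numFieldNormedType.Exports.

Local Open Scope classical_set_scope.
Local Open Scope ring_scope.

(* Lebesgue measure on R^n, as the iterated product of the one-dimensional    *)
(* Lebesgue measure, carried over to n.-tuple R.                              *)
Section lebesgue_cons.
Context (R : realType) (n : nat).
Variable m : {sigma_finite_measure set (n.-tuple R) -> \bar R}.

Definition pair_cons (p : measurableTypeR R * n.-tuple R) : n.+1.-tuple R :=
  [tuple of p.1 :: p.2].

Lemma measurable_pair_cons : measurable_fun [set: _] pair_cons.
Proof. exact: (measurable_cons measurable_fst measurable_snd). Qed.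

Definition lebesgue_cons : set (n.+1.-tuple R) -> \bar R :=
  pushforward (@lebesgue_measure R \x m)%E pair_cons.

Let lebesgue_cons0 : (lebesgue_cons set0 = 0)%E.
Proof. by rewrite /lebesgue_cons /pushforward preimage_set0 measure0. Qed.

Let lebesgue_cons_ge0 A : (0 <= lebesgue_cons A)%E.
Proof.
by rewrite /lebesgue_cons /pushforward; exact: (measure_ge0 (@lebesgue_measure R \x m)%E).
Qed.

Let measurable_preimage A : measurable A -> measurable (pair_cons @^-1` A).
Proof.
by move=> mA; rewrite -[X in measurable X]setTI; exact: measurable_pair_cons.
Qed.

Let lebesgue_cons_sigma_additive : semi_sigma_additive lebesgue_cons.
Proof.
move=> F mF tF mUF; rewrite /lebesgue_cons /pushforward preimage_bigcup.
apply: (@measure_semi_sigma_additive _ _ _ (@lebesgue_measure R \x m)%E).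
- by move=> i; exact: measurable_preimage.
- apply/trivIsetP => i j _ _ ij; rewrite -preimage_setI.
  by move/trivIsetP : tF => /(_ _ _ _ _ ij) ->//; rewrite preimage_set0.
- by rewrite -preimage_bigcup; exact: measurable_preimage.
Qed.

HB.instance Definition _ := isMeasure.Build _ _ _ lebesgue_cons
  lebesgue_cons0 lebesgue_cons_ge0 lebesgue_cons_sigma_additive.

Let lebesgue_cons_sigma_finite : sigma_finite setT lebesgue_cons.
Proof.
have /sigma_finiteP[F [FT ndF Foo]] := sigma_finiteT (@lebesgue_measure R).
have /sigma_finiteP[G [GT ndG Goo]] := sigma_finiteT m.
pose hd (t : n.+1.-tuple R) : R := tnth t ord0.
pose tl (t : n.+1.-tuple R) : n.-tuple R := [tuple of behead t].
have mhd : measurable_fun setT hd by exact: measurable_tnth.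
have mtl : measurable_fun setT tl by exact: measurable_behead.
exists (fun i => hd @^-1` F i `&` tl @^-1` G i).
  apply/seteqP; split=> // t _.
  have [i _ Fi] : (\bigcup_i F i) (hd t) by rewrite -FT.
  have [j _ Gj] : (\bigcup_i G i) (tl t) by rewrite -GT.
  exists (maxn i j) => //; split=> /=.
  - by move: Fi; exact/subsetPset/ndF/leq_maxl.
  - by move: Gj; exact/subsetPset/ndG/leq_maxr.
move=> i; have [mF Fi] := Foo i; have [mG Gi] := Goo i; split.
  apply: measurableI; rewrite -[X in measurable X]setTI.
    exact: mhd.
  exact: mtl.
rewrite /lebesgue_cons /pushforward.
rewrite (_ : _ @^-1` _ = F i `*` G i).
  by rewrite product_measure1E// lte_mul_pinfty// ge0_fin_numE.
apply/seteqP; split=> -[x t] /=; rewrite /hd /tl /= (_ : [tuple of _] = t) //;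
  exact: val_inj.
Qed.

HB.instance Definition _ := Measure_isSigmaFinite.Build _ _ _ lebesgue_cons
  lebesgue_cons_sigma_finite.

End lebesgue_cons.

Fixpoint lebesgue_tuple (R : realType) (n : nat) :
    {sigma_finite_measure set (n.-tuple R) -> \bar R} :=
  match n with
  | 0 => dirac [tuple]
  | n'.+1 => lebesgue_cons (lebesgue_tuple R n')
  end.

Section distributions.
Context {R : realType}.
Implicit Types (p q c : R) (n k : nat).

Definition gamma p : R :=
  \int[lebesgue_measure]_(x in `]0, +oo[) (x `^ (p - 1) * expR (- x)).

Definition beta_law p q (U : set R) : \bar R :=
  \int[lebesgue_measure]_(x in `]0%R, 1%R[ `&` U)
    (gamma (p + q) / (gamma p * gamma q) *
     x `^ (p - 1) * (1 - x) `^ (q - 1))%:E.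

Fixpoint pochhammer c n : R :=
  if n is n'.+1 then pochhammer c n' * (c + n'%:R) else 1.

Definition open_simplex n : set (n.-tuple R) :=
  [set x | (forall i, 0 < tnth x i) /\ \sum_(i < n) tnth x i < 1].

Definition add_coord0 n (x : n.-tuple R) : n.+1.-tuple R :=
  [tuple of (1 - \sum_(i < n) tnth x i) :: x].

(* D(a_0, ..., a_n) for positive parameters. Since R^0 is a single point of   *)
(* Lebesgue measure 1, dirichlet_pos 0 a is the Dirac mass at the vertex (1). *)
Definition dirichlet_pos n (a : 'I_n.+1 -> R) (U : set (n.+1.-tuple R)) :
    \bar R :=
  \int[lebesgue_tuple R n]_(x in @open_simplex n `&` @add_coord0 n @^-1` U)
    (gamma (\sum_(i < n.+1) a i) / \prod_(i < n.+1) gamma (a i) *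
     (1 - \sum_(i < n) tnth x i) `^ (a ord0 - 1) *
     \prod_(i < n) (tnth x i) `^ (a (lift ord0 i) - 1))%:E.

(* The linear map R^m -> R^(n+1) sending the j-th basis vector to e_(T_j).    *)
Definition face_embedding n m (T : seq 'I_n.+1) (x : m.-tuple R) :
    n.+1.-tuple R :=
  [tuple if i \in T then nth 0 x (index i T) else 0 | i < n.+1].

(* D(b_0, ..., b_n) for nonnegative parameters, not all zero. The parameters  *)
(* (b_i)_(i in T) are indexed by 'I_((size T).-1.+1), which is 'I_(size T) as *)
(* T is then nonempty.                                                        *)
Definition dirichlet n (b : 'I_n.+1 -> R) : set (n.+1.-tuple R) -> \bar R :=
  let T := [seq i <- enum 'I_n.+1 | 0 < b i] in
  pushforward
    (@dirichlet_pos (size T).-1 (fun j => b (nth ord0 T j)))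
    (@face_embedding n (size T).-1.+1 T).

(* The b in N^(n+1) with b_0 + ... + b_n = k have all their entries <= k.     *)
Definition quasi_bernoulli k n (a : 'I_n.+1 -> R) (U : set (n.+1.-tuple R)) :
    \bar R :=
  ((k`!%:R / pochhammer (\sum_(i < n.+1) a i) k)%:E *
   \sum_(b : {ffun 'I_n.+1 -> 'I_k.+1} | (\sum_(i < n.+1) b i == k)%N)
     ((\prod_(i < n.+1) (pochhammer (a i) (b i) / (b i)`!%:R))%:E *
      dirichlet (fun i => (b i)%:R) U))%E.

End distributions.

Section random_probabilities.
Context d d' (S : measurableType d) (Omega : measurableType d') (R : realType).
Variable P : probability S R.

Definition has_law dT (T : measurableType dT) (Z : S -> T)
    (mu : set T -> \bar R) : Prop :=
  forall U, measurable U -> P (Z @^-1` U) = mu U.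

Definition measurable_partition n (A : 'I_n.+1 -> set Omega) : Prop :=
  [/\ forall i, measurable (A i), trivIset setT A & \bigcup_i A i = setT].

(* The library's pprobability Omega R is the space of probabilities on Omega  *)
(* with the sigma-algebra generated by the evaluations mu |-> mu A, so that a *)
(* random probability is a random variable valued in that space.              *)
Definition random_value (X : {RV P >-> pprobability Omega R}) (s : S)
    (A : set Omega) : R :=
  fine ((X s : probability Omega R) A).

Definition partition_vector (Z : S -> set Omega -> R) n
    (A : 'I_n.+1 -> set Omega) (s : S) : n.+1.-tuple R :=
  [tuple Z s (A i) | i < n.+1].

Definition dirichlet_process (alpha : {measure set Omega -> \bar R})
    (X : {RV P >-> pprobability Omega R}) : Prop :=
  forall n (A : 'I_n.+1 -> set Omega), measurable_partition A ->
    has_law (partition_vector (random_value X) A)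
            (dirichlet (fun i => fine (alpha (A i)))).

Definition quasi_bernoulli_process (k : nat)
    (alpha : {measure set Omega -> \bar R})
    (X : {RV P >-> pprobability Omega R}) : Prop :=
  forall n (A : 'I_n.+1 -> set Omega), measurable_partition A ->
    has_law (partition_vector (random_value X) A)
            (quasi_bernoulli k (fun i => fine (alpha (A i)))).

(* Random set functions rather than random probabilities: (1 - Y) X + Y B is  *)
(* a probability only where Y lies in [0, 1], that is, almost surely.         *)
Definition eq_in_law (Z1 Z2 : S -> set Omega -> R) : Prop :=
  forall n (A : 'I_n.+1 -> set Omega), measurable_partition A ->
    forall U, measurable U ->
      P (partition_vector Z1 A @^-1` U) = P (partition_vector Z2 A @^-1` U).

Definition random_mixture (Y : {RV P >-> R})
    (X B : {RV P >-> pprobability Omega R}) (s : S) (A : set Omega) : R :=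
  (1 - Y s) * random_value X s A + Y s * random_value B s A.

Definition independent3 d1 d2 d3 (T1 : measurableType d1)
    (T2 : measurableType d2) (T3 : measurableType d3)
    (Z1 : {RV P >-> T1}) (Z2 : {RV P >-> T2}) (Z3 : {RV P >-> T3}) : Prop :=
  forall U1 U2 U3, measurable U1 -> measurable U2 -> measurable U3 ->
    (P (Z1 @^-1` U1 `&` Z2 @^-1` U2 `&` Z3 @^-1` U3) =
     P (Z1 @^-1` U1) * P (Z2 @^-1` U2) * P (Z3 @^-1` U3))%E.

End random_probabilities.

(* Main.v *)
Require Import Defs.
From HB Require Import structures.
From mathcomp Require Import all_boot all_order all_algebra.
From mathcomp Require Import all_classical all_reals all_analysis.
From mathcomp Require Import measurable_realfun.
From mathcomp Require Import ring.

(* Let G(a) be the product of the gamma laws of parameters a_0, ..., a_n, where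
   a gamma law of parameter 0 is the Dirac mass at 0. Under G(a), the sum s and
   the direction x / s are independent, the sum has the gamma law of parameter
   a_0 + ... + a_n, and the direction has the law D(a). For n = 1 this gives the
   convolution rule of gamma laws and the law beta(k, a) as that of t / (s + t),
   with s and t independent gamma variables of parameters a and k.

   If x and z are independent with laws G(a) and G(b), then x + z has the law
   G(a + b), and its direction is the combination of the directions of x and z
   with weights s / (s + t) and t / (s + t), s and t being the two sums. Hence
   (1 - Y) X + Y D has the law D(a + b) when X, D, Y are independent with laws
   D(a), D(b), beta(k, a), where k = b_0 + ... + b_n.

   Since (a_0)_(b_0) ... (a_n)_(b_n) G(a + b)(dx) = x^b G(a)(dx), the multinomial
   theorem turns the mixture of the G(a + b) with the quasi Bernoulli weights into
   the measure s^k / (a)_k G(a)(dx), under which the direction x / s still has the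
   law D(a), by independence of s and x / s. *)

Set Implicit Arguments.
Unset Strict Implicit.
Unset Printing Implicit Defensive.

Import Order.TTheory GRing.Theory Num.Theory.
Import numFieldNormedType.Exports.

Local Open Scope classical_set_scope.
Local Open Scope ring_scope.

(** * Densities, image laws and uniqueness of product laws *)

(** Zero parameters shape the proof. A quasi Bernoulli law charges [D(b)] for many [b] with some
    [b_i = 0], and cells of measure 0 give [a_i = 0]; in neither case is there a density on the
    whole simplex. Densities are therefore confined to one computation, the change of variables from
    [x] to [(s, x / s)] for positive parameters. The rest consists of identities between integrals
    of nonnegative functions under gamma laws, and these extend to parameter 0: the Dirac mass at 0
    is neutral for addition, and [(0)_n] vanishes together with [0^n] for [n > 0]. The law of [Y]
    depends on [b] only through the total [k]. One and the same [Y] thus serves every component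
    [D(b)] of the mixture, and the sum over [b] can be taken out of the integrals. In the statement
    [dirichlet], [beta_law] and [quasi_bernoulli] are bare set functions. The first two are replaced
    by image laws of products of gamma laws and the third by a combination of such laws, so that
    Tonelli's theorem is available. *)

Section integral_density.
Local Open Scope ereal_scope.
Context d (T : measurableType d) (R : realType).
Variables (m nu : {measure set T -> \bar R}) (w : T -> R).
Hypotheses (mw : measurable_fun setT w) (w0 : forall x, (0 <= w x)%R).
Hypothesis nuE : forall U, measurable U -> nu U = \int[m]_(x in U) (w x)%:E.

Import HBNNSimple.

Let mwE : measurable_fun setT (fun x => (w x)%:E). Proof. exact/measurable_EFinP. Qed.

Let integral_density_nnsfun (h : {nnsfun T >-> R}) :
  \int[nu]_x (h x)%:E = \int[m]_x ((h x)%:E * (w x)%:E).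
Proof.
under [LHS]eq_integral do rewrite fimfunE -fsumEFin//.
rewrite [LHS]ge0_integral_fsum//; last 2 first.
  - by move=> r; exact/measurable_EFinP/measurableT_comp.
  - by move=> n x _; rewrite EFinM nnfun_muleindic_ge0.
under [RHS]eq_integral.
  move=> x xD; rewrite fimfunE -fsumEFin// ge0_mule_fsuml; last first.
    by move=> r; rewrite EFinM nnfun_muleindic_ge0.
  over.
rewrite [RHS]ge0_integral_fsum//; last 2 first.
  - move=> r; apply: emeasurable_funM => //.
    by apply/measurable_EFinP; do 2 apply/measurableT_comp => //.
  - by move=> n x _; rewrite EFinM mule_ge0 ?lee_fin// -lee_fin EFinM nnfun_muleindic_ge0.
apply: eq_fsbigr => r _.
rewrite integralZl_indic_nnsfun// integral_indic//= setIT nuE//.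
(* A negative [r] is not a value of the nonnegative [h]: its level set is empty and both sides are
   0. *)
have [r0|r0] := leP 0%R r; last first.
  rewrite preimage_nnfun0// integral_set0 mule0.
  by rewrite integral0_eq// => x _; rewrite indic0 mulr0 mul0e.
under [RHS]eq_integral do rewrite EFinM -muleA.
rewrite ge0_integralZl//.
- congr (_ * _); rewrite [LHS]integral_mkcond.
  apply: eq_integral => x _; rewrite patchE indicE.
  by case: ifPn => _; rewrite ?mul1e ?mul0e.
- by apply: emeasurable_funM => //; exact/measurable_EFinP.
- by move=> x _; rewrite mule_ge0 ?lee_fin.
Qed.

(** The simple functions of [nnsfun_approx] increase to [f], and monotone convergence applies on
    both sides, as the weight [w] is nonnegative. *)
Lemma ge0_integral_density (f : T -> \bar R) :
  measurable_fun setT f -> (forall x, 0 <= f x) ->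
  \int[nu]_x f x = \int[m]_x (f x * (w x)%:E).
Proof.
move=> mf f0; pose f_ := nnsfun_approx measurableT mf.
transitivity (limn (fun n => \int[nu]_x (f_ n x)%:E)).
  rewrite -monotone_convergence//=.
  - apply: eq_integral => x _; apply/esym/cvg_lim => //=.
    exact: cvg_nnsfun_approx.
  - by move=> n; apply: measurableT_comp.
  - by move=> n x _; rewrite lee_fin.
  - by move=> x _ a b ab; rewrite lee_fin//; exact/lefP/nd_nnsfun_approx.
under eq_fun do rewrite integral_density_nnsfun.
rewrite -monotone_convergence//=.
- apply: eq_integral => x _; apply/cvg_lim => //.
  apply: cvgeZr => //; exact: cvg_nnsfun_approx.
- by move=> n; apply: emeasurable_funM => //; apply: measurableT_comp.
- by move=> n x _; rewrite mule_ge0 ?lee_fin.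
- move=> x _ a b ab; rewrite lee_wpmul2r ?lee_fin//.
  exact/lefP/nd_nnsfun_approx.
Qed.

End integral_density.

Section law.
Context d1 d2 (T1 : measurableType d1) (T2 : measurableType d2) (R : realType).
Variables (mu : probability T1 R) (f : T1 -> T2).
Hypothesis mf : measurable_fun setT f.

Definition law : probability T2 R :=
  distribution mu (HB.pack f (isMeasurableFun.Build _ _ _ _ _ mf) : {mfun T1 >-> T2}).

Lemma lawE U : law U = mu (f @^-1` U). Proof. by []. Qed.

Lemma ge0_integral_law (g : T2 -> \bar R) : measurable_fun setT g ->
  (forall y, 0 <= g y)%E -> (\int[law]_y g y = \int[mu]_x g (f x))%E.
Proof. by move=> mg g0; rewrite ge0_integral_distribution. Qed.

End law.

(* The measure instance of [pushforward] has a measurability premise, which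
   unification cannot supply. *)
Definition pushforward_measure d1 d2 (T1 : measurableType d1)
    (T2 : measurableType d2) (R : realType) (m : {measure set T1 -> \bar R})
    (f : T1 -> T2) (mf : measurable_fun setT f) : {measure set T2 -> \bar R} :=
  measure_function_pushforward__canonical__measure_function_Measure m mf.

Section product_uniqueness.
Local Open Scope ereal_scope.
Context d1 d2 (T1 : measurableType d1) (T2 : measurableType d2) (R : realType).

(** Rectangles are stable under intersection and generate the product sigma-algebra. The whole space
    is itself a rectangle, of finite mass, so the constant sequence [setT] is the exhaustion that
    the uniqueness theorem asks for. *)
Lemma measure_eq_on_rectangles (m m' : {measure set (T1 * T2) -> \bar R}) :
  m setT < +oo ->
  (forall A B, measurable A -> measurable B -> m (A `*` B) = m' (A `*` B)) ->
  forall U, measurable U -> m U = m' U.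
Proof.
move=> moo mm'.
pose C : set (set (T1 * T2)) :=
  [set C | exists A, measurable A /\ exists B, measurable B /\ C = A `*` B].
have CI : setI_closed C.
  move=> /= _ _ [X1 [mX1 [X2 [mX2 ->]]]] [Y1 [mY1 [Y2 [mY2 ->]]]].
  rewrite -setXI; exists (X1 `&` Y1); split; first exact: measurableI.
  by exists (X2 `&` Y2); split => //; exact: measurableI.
move=> U mU; apply: (measure_unique C (fun=> setT)) => //.
- rewrite measurable_prod_measurableType //; congr (<<s _ >>).
  rewrite predeqE; split => [[A mA [B mB <-]]|[A [mA [B [mB ->]]]]].
    by exists A; split => //; exists B.
  by exists A => //; exists B.
- by move=> n; exists setT; split => //; exists setT; split => //; rewrite setXTT.
- by rewrite bigcup_const//; exists 0%N.
- by move=> _ [A [mA [B [mB ->]]]]; exact: mm'.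
Qed.

End product_uniqueness.

Section tuple_rectangles.
Local Open Scope ereal_scope.
Context d (T : measurableType d) (R : realType) (n : nat).

Definition tuple_rectangle (U : 'I_n -> set T) : set (n.-tuple T) :=
  [set x | forall i, U i (tnth x i)].

Lemma measurable_tuple_rectangle (U : 'I_n -> set T) :
  (forall i, measurable (U i)) -> measurable (tuple_rectangle U).
Proof.
move=> mU; rewrite (_ : tuple_rectangle U =
    \big[setI/setT]_(i < n) ((@tnth n T)^~ i @^-1` U i)).
  apply: bigsetI_measurable => i _; rewrite -[X in measurable X]setTI.
  exact: measurable_tnth.
rewrite -bigcap_seq; apply/seteqP; split=> x /=.
  by move=> Ux i _; exact: Ux.
by move=> Ux i; apply: Ux; rewrite /= mem_index_enum.
Qed.

(** The same uniqueness argument for tuples. It identifies image laws of gamma products even when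
    some coordinates are Dirac masses. *)
Lemma probability_eq_on_tuple_rectangles (m m' : probability (n.-tuple T) R) :
  (forall U, (forall i, measurable (U i)) ->
     m (tuple_rectangle U) = m' (tuple_rectangle U)) ->
  forall V, measurable V -> m V = m' V.
Proof.
move=> mm'; have moo : m setT < +oo by rewrite probability_setT ltry.
pose C : set (set (n.-tuple T)) :=
  [set C | exists2 U, forall i, measurable (U i) & C = tuple_rectangle U].
have CI : setI_closed C.
  move=> /= _ _ [U mU ->] [V mV ->].
  exists (fun i => U i `&` V i); first by move=> i; exact: measurableI.
  apply/seteqP; split=> x /=; first by move=> [Ux Vx] i.
  by move=> UVx; split=> i; have [] := UVx i.
move=> V mV; apply: (measure_unique C (fun=> setT)) => //.
- apply/seteqP; split; last first.
    apply: smallest_sub; first exact: sigma_algebra_measurable.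
    by move=> _ [U mU ->]; exact: measurable_tuple_rectangle.
  apply: smallest_sub; first exact: smallest_sigma_algebra.
  move=> A; rewrite -bigcup_seq => -[i _ [B mB <-]].
  apply: sub_sigma_algebra.
  (* A cylinder over the coordinate [i] is the rectangle whose other sides are the whole space. *)
  exists (fun j => if j == i then B else setT).
    by move=> j; case: ifP.
  rewrite setTI; apply/seteqP; split=> x /=.
    by move=> Bx j; case: eqP => [->|].

  by move=> /(_ i); rewrite eqxx.
- move=> _; exists (fun=> setT) => //.
  by apply/seteqP; split.
- by rewrite bigcup_const//; exists 0%N.
- by move=> _ [U mU ->]; exact: mm'.
Qed.

End tuple_rectangles.

(** * The Gamma function *)

Section gamma_function.
Context {R : realType}.
Implicit Types (p x u : R).
Local Notation mu := (@lebesgue_measure R).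

Lemma integral_expRN_itvcy u :
  (\int[mu]_(x in `[u, +oo[) (expR (- x))%:E = (expR (- u))%:E)%E.
Proof.
have cN : continuous (fun x : R => expR (- x)).
  move=> x; apply: continuous_comp; last exact: continuous_expR.
  exact: continuousN.
rewrite (@ge0_continuous_FTC2y _ _ (fun x => - expR (- x)) _ 0).
- by rewrite EFinN sub0e oppeK.
- by move=> x _; exact: expR_ge0.
- exact: continuous_subspaceT.
- by rewrite -[X in _ --> X]oppr0; apply: cvgN; exact: cvgr_expR.
- by move=> x _; exact: ex_derive.
- by apply/cvg_at_right_filter; apply: cvgN; exact: cN.
- by move=> x _; rewrite derive1E derive_val/= mulrN1 opprK.
Qed.

(** For [p < 1] the integrand is unbounded at 0, so the fundamental theorem of calculus is applied
    on closed intervals increasing to []0, x]], followed by a passage to the limit. *)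
Lemma integral_powR_itv0c p x : 0 < p -> 0 < x ->
  (\int[mu]_(u in `]0%R, x]) (p * u `^ (p - 1))%:E = (x `^ p)%:E)%E.
Proof.
move=> p0 x0.
(* With [i.+2] the left end is strictly below [x] already for [i = 0], as the fundamental theorem
   requires. *)
pose F (i : nat) : set R := `[x / i.+2%:R, x]%classic.
have xi0 i : 0 < x / i.+2%:R by rewrite divr_gt0.
have FE : `]0, x]%classic = \bigcup_i F i.
  apply/seteqP; split=> u /=; rewrite in_itv/=.
    move=> /andP[u0 ux]; exists (Num.truncn (x / u)) => //.
    rewrite /F/= in_itv/= ux andbT ler_pdivrMr// mulrC -ler_pdivrMr//.
    by rewrite (le_trans (ltW (truncnS_gt _)))// ler_nat.
  move=> [i _]; rewrite /F/= in_itv/= => /andP[iu ->]; rewrite andbT.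
  exact: lt_le_trans iu.
have mf : measurable_fun setT (fun u : R => (p * u `^ (p - 1))%:E).
  exact/measurable_EFinP/measurable_funM.
have intF i : (\int[mu]_(u in F i) (p * u `^ (p - 1))%:E =
               (x `^ p)%:E - ((x / i.+2%:R) `^ p)%:E)%E.
  have xix : x / i.+2%:R < x.
    by rewrite ltr_pdivrMr// ltr_pMr// ltr1n.
  have dpow (q y : R) : 0 < y -> {for y, continuous (@powR R ^~ q)}.
    move=> y0; apply: differentiable_continuous.
    by apply/derivable1_diffP/derivable_powR; rewrite in_itv/= y0.
  apply: (@continuous_FTC2 _ _ (fun u => u `^ p)) => //.
  - apply: continuous_in_subspaceT => u; rewrite inE/= in_itv/= => /andP[xu _].
    have u0 := lt_le_trans (xi0 i) xu.
    apply: cvgM; first exact: cvg_cst.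
    exact: dpow.
  - split.
    + move=> u; rewrite in_itv/= => /andP[xu _].
      by apply: derivable_powR; rewrite in_itv/= andbT (lt_trans (xi0 i)).
    + by apply: cvg_at_right_filter; exact: dpow.
    + by apply: cvg_at_left_filter; exact: dpow.
  - move=> u; rewrite in_itv/= => /andP[xu _].
    by rewrite powR_derive1// in_itv/= andbT (lt_trans (xi0 i)).
rewrite FE.
have /cvg_lim <- // : (\int[mu]_(u in F i) (p * u `^ (p - 1))%:E @[i --> \oo] -->
    \int[mu]_(u in \bigcup_i F i) (p * u `^ (p - 1))%:E)%E.
  apply: ge0_nondecreasing_set_cvg_integral => //.
  - move=> i j ij; apply/subsetPset => u; rewrite /F/= !in_itv/= => /andP[iu ->].
    rewrite andbT (le_trans _ iu)// ler_pM2l// lef_pV2 ?posrE//.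
    by rewrite ler_nat !ltnS.
  - by move=> i; exact: measurable_itv.
  - by move=> i; exact: measurable_funTS.
  - by move=> i u _; rewrite lee_fin mulr_ge0 ?powR_ge0// ltW.
apply/cvg_lim => //.
under eq_fun do rewrite intF -EFinB.
apply: cvg_EFin; first by near=> i.
rewrite -[X in _ --> X]subr0 /comp /=.
apply: cvgB; first exact: cvg_cst.
apply: (@cvg_comp _ _ _ (fun i : nat => x / i.+2%:R) (@powR R ^~ p) _ (0:R)^'+);
  last exact: powR_cvg0.
have x0cvg : x / i.+2%:R @[i --> \oo] --> (0 : R).
  rewrite -(mulr0 x); apply: cvgM; first exact: cvg_cst.
  by have := @cvg_harmonic R; rewrite -cvg_shiftS.
move=> A hA; have [N _ NA] := x0cvg _ hA; exists N => // i Ni.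
by apply: (NA i Ni); exact: xi0.
Unshelve. all: by end_near. Qed.


Definition gamma_integrand p x := if 0 < x then x `^ (p - 1) * expR (- x) else 0.

Lemma gamma_integrand_ge0 p x : 0 <= gamma_integrand p x.
Proof.
by rewrite /gamma_integrand; case: ifP => // _; rewrite mulr_ge0 ?powR_ge0 ?expR_ge0.
Qed.

Lemma measurable_gamma_integrand p : measurable_fun setT (gamma_integrand p).
Proof.
apply: measurable_fun_ifT => //; first exact: measurable_fun_ltr.
apply: measurable_funM => //.
by apply: measurableT_comp.
Qed.

(** The real number [gamma p] is the [fine] part of this integral and says nothing until finiteness
    is known. The functional equation is proved here first, in [[0, +oo]], and then serves to prove
    finiteness. *)
Definition egamma p : \bar R := (\int[mu]_x (gamma_integrand p x)%:E)%E.

Lemma egamma_ge0 p : (0 <= egamma p)%E.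
Proof. by apply: integral_ge0 => x _; rewrite lee_fin gamma_integrand_ge0. Qed.

Lemma gammaE p : gamma p = fine (egamma p).
Proof.
rewrite /gamma /Rintegral /egamma integral_mkcond; congr fine.
apply: eq_integral => x _; rewrite patchE mem_setE in_itv/= andbT /gamma_integrand.
by case: ifP.
Qed.

(* The double integral of [p u^(p-1) e^(-x)] over [0 < u <= x], computed in both orders. *)
Lemma egammaD1 p : 0 < p -> egamma (p + 1) = (p%:E * egamma p)%E.
Proof.
move=> p0.
pose f (z : R * R) : \bar R :=
  if (0 < z.2) && (z.2 <= z.1) then (p * z.2 `^ (p - 1) * expR (- z.1))%:E else 0%E.
have mf : measurable_fun setT f.
  apply: measurable_fun_ifT => //.
    apply: measurable_and; first exact: measurable_fun_ltr.
    exact: measurable_fun_ler.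
  apply/measurable_EFinP; apply: measurable_funM.
    apply: measurable_funM => //.
    by apply: (measurableT_comp (measurable_powR _)).
  by do 2 apply: measurableT_comp => //.
have f0 z : (0 <= f z)%E.
  rewrite /f; case: ifP => // _.
  by rewrite lee_fin !mulr_ge0 ?powR_ge0 ?expR_ge0 ?ltW.
have mpow (q : R) : measurable_fun setT (fun u : R => (p * u `^ q)%:E).
  exact/measurable_EFinP/measurable_funM.
have := fubini_tonelli (m1 := mu) (m2 := mu) f mf f0.
rewrite (_ : (fun x => _) = fun x => (gamma_integrand (p + 1) x)%:E); last first.
  apply/funext => x; rewrite /gamma_integrand; case: ifPn => x0; last first.
    rewrite integral0_eq// => u _; rewrite /f /=; case: ifPn => // /andP[u0 ux].
    by rewrite (lt_le_trans u0 ux) in x0.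
  rewrite addrK -[X in (X * _)%:E]/(x `^ p) EFinM -(integral_powR_itv0c p0 x0).
  rewrite muleC -ge0_integralZl//; last 2 first.

  - by apply: measurable_funTS; exact: mpow.
  - by move=> u _; rewrite lee_fin mulr_ge0 ?powR_ge0 ?ltW.
  rewrite [RHS]integral_mkcond; apply: eq_integral => u _.
  rewrite patchE mem_setE in_itv/= /f/=; case: ifP => // _.
  by rewrite -EFinM mulrC.
rewrite -/(egamma _) => ->.
rewrite (_ : (fun u => _) = fun u => (p%:E * (gamma_integrand p u)%:E)%E); last first.
  apply/funext => u; rewrite /gamma_integrand; case: ifPn => u0; last first.
    by rewrite integral0_eq ?mule0// => x _; rewrite /f /= (negbTE u0).
  rewrite -EFinM mulrA EFinM -integral_expRN_itvcy -ge0_integralZl//; last 2 first.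
  - apply/measurable_funTS/measurable_EFinP.
    by apply: measurableT_comp.
  - by rewrite lee_fin mulr_ge0 ?powR_ge0 ?ltW.
  rewrite [RHS]integral_mkcond; apply: eq_integral => x _.
  by rewrite patchE mem_setE in_itv/= andbT /f/= u0/=; case: ifP.
rewrite ge0_integralZl//.
- by apply/measurable_EFinP; exact: measurable_gamma_integrand.
- by move=> x _; rewrite lee_fin gamma_integrand_ge0.
- by rewrite lee_fin ltW.
Qed.

Lemma egamma1 : egamma 1 = 1%E.
Proof.
transitivity ((expR (- 0))%:E : \bar R); last by rewrite oppr0 expR0.
rewrite -integral_expRN_itvcy.
rewrite -integral_itv_obnd_cbnd; last first.
  apply/measurable_funTS/measurable_EFinP.
  by apply: measurableT_comp.
rewrite [RHS]integral_mkcond; apply: eq_integral => x _.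
rewrite patchE mem_setE in_itv/= andbT /gamma_integrand.
by case: ifP => // x0; rewrite subrr powRr0 mul1r.
Qed.

Lemma egamma_natS n : egamma n.+1%:R = n`!%:R%:E.
Proof.
elim: n => [|n IHn]; first by rewrite egamma1.
by rewrite -natr1 egammaD1// IHn factS natrM EFinM.
Qed.

(* On the positive half-line [x^p <= 1 + x^n] whenever [0 <= p <= n]. *)
Lemma egamma_lty p : 0 < p -> (egamma p < +oo)%E.
Proof.
(* For a parameter below 1 the power is singular at 0; the functional equation transfers finiteness
   from [p + 1 >= 1] to [p]. *)
suff ge1 q : 1 <= q -> (egamma q < +oo)%E.
  move=> p0; have := ge1 (p + 1); rewrite lerDr ltW// => /(_ isT).
  rewrite egammaD1//; have := egamma_ge0 p; case: (egamma p) => [r _ _|_|//].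
    exact: ltry.
  by rewrite gt0_muley// ltxx.
move=> q1; pose n := (Num.truncn q).+1.
have qn : q - 1 <= n%:R.
  by apply: le_trans (ltW (truncnS_gt q)); rewrite gerBl.
apply: (@le_lt_trans _ _ (egamma 1 + egamma n.+1%:R)%E); last first.
  by rewrite egamma_natS egamma1 -EFinD ltry.
have mg r : measurable_fun setT (fun x : R => (gamma_integrand r x)%:E).
  by apply/measurable_EFinP; exact: measurable_gamma_integrand.
have g0 r x : (0 <= (gamma_integrand r x)%:E)%E.
  by rewrite lee_fin gamma_integrand_ge0.
rewrite /egamma -ge0_integralD//; [|exact: mg|exact: mg].
apply: ge0_le_integral => //; [exact: mg|exact: emeasurable_funD (mg _) (mg _)|].
move=> x _; rewrite -EFinD lee_fin /gamma_integrand.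
case: ifPn => x0; last by rewrite addr0.
rewrite -mulrDl ler_wpM2r ?expR_ge0// subrr powRr0.
rewrite -natr1 addrK (powR_mulrn _ (ltW x0)).
have [x1|x1] := leP x 1.
    apply: (@le_trans _ _ 1); last by rewrite lerDl exprn_ge0 ?ltW.
  by rewrite -[leRHS](powRr0 x) ger_powR ?x0 ?subr_ge0.
by rewrite (le_trans (ler_powR (ltW x1) qn))// (powR_mulrn _ (ltW x0)) lerDr.
Qed.

Lemma egammaE p : 0 < p -> egamma p = (gamma p)%:E.
Proof.
by move=> p0; rewrite gammaE fineK// ge0_fin_numE ?egamma_lty ?egamma_ge0.
Qed.

Lemma gammaD1 p : 0 < p -> gamma (p + 1) = p * gamma p.
Proof.
move=> p0; apply: EFin_inj.
by rewrite -egammaE ?addr_gt0// egammaD1// egammaE.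
Qed.

(** In fact [p * gamma p >= expR (-1)]: on []0, 1]] the exponential is at least [expR (-1)], and the
    integral of [p u^(p-1)] over that interval is 1. *)
Lemma gamma_gt0 p : 0 < p -> 0 < gamma p.
Proof.
move=> p0; rewrite -(pmulr_rgt0 _ p0) -lte_fin EFinM -egammaE//.
apply: (@lt_le_trans _ _ (expR (-1))%:E); first by rewrite lte_fin expR_gt0.
rewrite -[leLHS]mule1 -[X in (_ * X)%E](_ : (1 `^ p)%:E = 1%E); last by rewrite powR1.
rewrite -integral_powR_itv0c//.
have mpow : measurable_fun setT (fun u : R => (p * u `^ (p - 1))%:E).
  exact/measurable_EFinP/measurable_funM.
have mg : measurable_fun setT (fun x : R => (gamma_integrand p x)%:E).
  by apply/measurable_EFinP; exact: measurable_gamma_integrand.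
rewrite -[leLHS]ge0_integralZl//; last 2 first.
- by apply: measurable_funTS; exact: mpow.
- by move=> u _; rewrite lee_fin mulr_ge0 ?powR_ge0 ?ltW.
rewrite -[leRHS]ge0_integralZl//; last 2 first.
- by move=> x _; rewrite lee_fin gamma_integrand_ge0.
- by rewrite lee_fin ltW.
rewrite integral_mkcond; apply: ge0_le_integral => //.
- move=> x _; rewrite patchE; case: ifP => // _.
  by rewrite lee_fin !mulr_ge0 ?powR_ge0 ?expR_ge0 ?ltW.
- apply/(measurable_restrictT _ _).1 => //.
  by apply: measurable_funTS; apply: measurable_funeM; exact: mpow.
- by apply: measurable_funeM; exact: mg.
move=> x _; rewrite patchE mem_setE in_itv/=; case: ifPn => [/andP[x0 x1]|_].
  rewrite -!EFinM lee_fin /gamma_integrand x0 mulrCA ler_pM2l// mulrC.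
  by rewrite ler_wpM2l ?powR_ge0// ler_expR lerN2.
by rewrite mule_ge0// lee_fin ?gamma_integrand_ge0// ltW.
Qed.

Lemma gamma_pochhammer p n : 0 < p -> gamma (p + n%:R) = pochhammer p n * gamma p.
Proof.
move=> p0; elim: n => [|n IHn]; first by rewrite addr0 mul1r.
by rewrite -natr1 addrA gammaD1 ?ltr_wpDr// IHn /= mulrA [_ * (p + _)]mulrC.
Qed.

End gamma_function.

(** * Gamma laws and their products *)

Section gamma_law.
Context {R : realType}.
Implicit Types (p x : R).
Local Notation mu := (@lebesgue_measure R).

Definition gamma_density p x := gamma_integrand p x / gamma p.

Lemma gamma_density_ge0 p x : 0 < p -> 0 <= gamma_density p x.
Proof.
by move=> p0; rewrite divr_ge0 ?gamma_integrand_ge0// ltW ?gamma_gt0.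
Qed.

Lemma gamma_density_eq0 p x : x <= 0 -> gamma_density p x = 0.
Proof. by move=> x0; rewrite /gamma_density /gamma_integrand ltNge x0 mul0r. Qed.

Lemma measurable_gamma_density p :
  measurable_fun [set: measurableTypeR R] (gamma_density p).
Proof. by apply: measurable_funM => //; exact: measurable_gamma_integrand. Qed.

Lemma integral_gamma_density p : 0 < p ->
  (\int[mu]_x (gamma_density p x)%:E = 1)%E.
Proof.
move=> p0; under eq_integral do rewrite EFinM.
have mg : measurable_fun [set: measurableTypeR R] (fun x => (gamma_integrand p x)%:E).
  by apply/measurable_EFinP; exact: measurable_gamma_integrand.
rewrite ge0_integralZr//.
- by rewrite -/(egamma p) egammaE// -EFinM divff// gt_eqF// gamma_gt0.
- by move=> x _; rewrite lee_fin gamma_integrand_ge0.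
- by rewrite lee_fin invr_ge0 ltW// gamma_gt0.
Qed.

(* The Dirac mass at 0 serves the cells of the partition of measure 0. *)
Definition gamma_law p (U : set (measurableTypeR R)) : \bar R :=
  if 0 < p then (\int[mu]_(x in U) (gamma_density p x)%:E)%E
  else dirac (0 : measurableTypeR R) U.

Let gamma_law0 p : gamma_law p set0 = 0%E.
Proof. by rewrite /gamma_law integral_set0 measure0 if_same. Qed.

Let gamma_law_ge0 p U : (0 <= gamma_law p U)%E.
Proof.
rewrite /gamma_law; case: ifP => [p0|_]; last exact: measure_ge0.
by apply: integral_ge0 => x _; rewrite lee_fin gamma_density_ge0.
Qed.

Let gamma_law_sigma_additive p : semi_sigma_additive (gamma_law p).
Proof.
move=> F mF tF mUF; rewrite /gamma_law; case: ifP => [p0|_]; last first.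
  exact: measure_semi_sigma_additive.
apply: cvg_toP.
  apply: ereal_nondecreasing_is_cvgn => m n mn.
  apply: lee_sum_nneg_natr => // k _ _; apply: integral_ge0 => /= x Fkx.
  by rewrite lee_fin gamma_density_ge0.
rewrite ge0_integral_bigcup//=.
- apply: measurable_funTS; apply/measurable_EFinP.
  exact: measurable_gamma_density.
- by move=> x _; rewrite lee_fin gamma_density_ge0.
Qed.

HB.instance Definition _ p := isMeasure.Build _ _ _
  (gamma_law p) (gamma_law0 p) (gamma_law_ge0 p) (@gamma_law_sigma_additive p).

Let gamma_law_setT p : gamma_law p setT = 1%E.
Proof.
rewrite /gamma_law; case: ifP => [p0|_]; first exact: integral_gamma_density.
exact: diracT.
Qed.

HB.instance Definition _ p :=
  @Measure_isProbability.Build _ _ R (gamma_law p) (gamma_law_setT p).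

Lemma ge0_integral_gamma_law p (f : measurableTypeR R -> \bar R) : 0 < p ->
  measurable_fun setT f -> (forall x, 0 <= f x)%E ->
  (\int[gamma_law p]_x f x = \int[mu]_x (f x * (gamma_density p x)%:E))%E.
Proof.
move=> p0 mf f0; apply: ge0_integral_density => //.
- exact: measurable_gamma_density.
- by move=> x; exact: gamma_density_ge0.
- by move=> U _; rewrite /= /gamma_law p0.
Qed.

Lemma ge0_integral_gamma_law0 p (f : measurableTypeR R -> \bar R) : p <= 0 ->
  measurable_fun setT f ->
  (\int[gamma_law p]_x f x = f 0%R)%E.
Proof.
move=> p0 mf.
rewrite (@eq_measure_integral _ _ _ _ (dirac (0 : measurableTypeR R))); last first.
  by move=> A _ _; rewrite /= /gamma_law ltNge p0.
by rewrite integral_dirac// diracT mul1e.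
Qed.

Lemma gamma_law_itv0y p : gamma_law p `[0, +oo[%classic = 1%E.
Proof.
rewrite /gamma_law; case: ifP => [p0|_]; last first.
  by rewrite diracE mem_set//= in_itv/= lexx.
rewrite -(integral_gamma_density p0) integral_mkcond; apply: eq_integral => x _.
rewrite patchE mem_setE in_itv/= andbT; case: ifPn => //; rewrite -ltNge => x0.
by rewrite gamma_density_eq0// ltW.
Qed.

(** For [p > 0] the quotient of the two densities is [x^n gamma p / gamma (p + n)], that is
    [x^n / (p)_n]. The absolute value makes the weight nonnegative on the whole line, while the laws
    live on the nonnegative half-line. *)
Lemma gamma_law_expn p n (f : measurableTypeR R -> \bar R) : 0 <= p ->
  measurable_fun setT f -> (forall x, 0 <= f x)%E ->
  ((pochhammer p n)%:E * \int[gamma_law (p + n%:R)%R]_x f x =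
   \int[gamma_law p]_x (f x * (`|x| ^+ n)%:E))%E.
Proof.
move=> p0 mf f0.
have mfn : measurable_fun setT (fun x : measurableTypeR R => f x * (`|x| ^+ n)%:E)%E.
  apply: emeasurable_funM => //; apply/measurable_EFinP.
  by apply: (@measurable_funX _ _ _ _ (fun x : measurableTypeR R => `|x|));
    exact: normr_measurable.
have fn0 x : (0 <= f x * (`|x| ^+ n)%:E)%E by rewrite mule_ge0// lee_fin exprn_ge0.
(* At [p = 0] both sides equal [f 0] if [n = 0]. Otherwise both vanish: [(0)_n] contains the factor
   0, and [|x|^n] is 0 at the atom. *)
move: p0; rewrite le_eqVlt => /predU1P[<-|p0].
  have I0 := ge0_integral_gamma_law0 (lexx (0 : R)).
  rewrite [RHS](I0 _ mfn).
  have [->|n0] := posnP n.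
    rewrite [pochhammer _ _]/= expr0 mule1 mul1e addr0.
    exact: I0.
  rewrite normr0 expr0n gtn_eqF// mule0.
  rewrite [X in (X%:E * _)%E](_ : _ = 0) ?mul0e//.
  case: n n0 {mfn fn0} => // n _; elim: n => [|n IHn]; first by rewrite /= mul1r addr0.
  by rewrite -[LHS]/(pochhammer 0 n.+1 * _) IHn mul0r.
have mfd q : measurable_fun [set: measurableTypeR R]
    (fun x => (f x * (gamma_density q x)%:E)%E).
  by apply: emeasurable_funM => //; apply/measurable_EFinP; exact: measurable_gamma_density.
have pn0 : 0 < p + n%:R by rewrite ltr_wpDr.
rewrite [RHS](ge0_integral_gamma_law p0 mfn fn0).
rewrite [X in (_ * X)%E](ge0_integral_gamma_law pn0 mf f0).
rewrite -[LHS]ge0_integralZl//; last 2 first.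
- by move=> x _; rewrite mule_ge0// lee_fin gamma_density_ge0.
- rewrite lee_fin -(pmulr_lge0 _ (gamma_gt0 p0)) -gamma_pochhammer//.
  by rewrite ltW// gamma_gt0.
apply: eq_integral => x _; rewrite muleCA -muleA -!EFinM; congr (_ * _%:E)%E.
rewrite /gamma_density /gamma_integrand; case: ifPn => [x0|]; last by rewrite !mul0r !mulr0.
have Pn0 : pochhammer p n != 0.
  have := gamma_gt0 pn0; rewrite gamma_pochhammer// pmulr_lgt0 ?gamma_gt0// => h.
  by rewrite gt_eqF.
have G0 : gamma p != 0 by rewrite gt_eqF ?gamma_gt0.
have -> : x `^ (p + n%:R - 1) = x ^+ n * x `^ (p - 1).
  by rewrite -powR_mulrn ?ltW// -powRD ?(gt_eqF x0) ?implybT//; congr (_ `^ _); ring.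
rewrite gamma_pochhammer// (ger0_norm (ltW x0)).
by field; rewrite Pn0 G0.
Qed.

End gamma_law.

(** * Affine maps, scalings and iterated integrals for Lebesgue measure *)

Section lebesgue_change_of_variables.
Context {R : realType}.
Local Notation mu := (@lebesgue_measure R).

Lemma measurable_affine (s c : R) :
  measurable_fun setT ((fun x => s * x + c) : measurableTypeR R -> measurableTypeR R).
Proof. by apply: measurable_funD => //; exact: measurable_funM. Qed.

(** The image of Lebesgue measure under [s * x + c], multiplied by [s], gives half-open intervals
    their length; uniqueness of Lebesgue measure does the rest. *)
Lemma ge0_integral_affine (s c : R) (f : measurableTypeR R -> \bar R) : 0 < s ->
  measurable_fun setT f -> (forall x, 0 <= f x)%E ->
  (\int[mu]_x f x = s%:E * \int[mu]_x f (s * x + c)%R)%E.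
Proof.
move=> s0 mf f0.
pose phi : measurableTypeR R -> measurableTypeR R := fun x => s * x + c.
have mphi : measurable_fun setT phi := measurable_affine s c.
pose s' : {nonneg R} := NngNum (ltW s0).
pose phimu := pushforward_measure mu mphi.
pose nu := mscale s' phimu.
transitivity (\int[nu]_x f x)%E.
  apply: eq_measure_integral => A mA _.
  apply: lebesgue_measure_unique => //= _ [[a b]] _ <-.
  rewrite /nu /= /mscale /= /pushforward.
  rewrite (_ : _ @^-1` _ = `](a - c) / s, (b - c) / s]%classic); last first.
    apply/seteqP; split=> x /=; rewrite !in_itv/= /phi;
      by rewrite ltr_pdivrMr// ler_pdivlMr// ltrBlDr lerBrDr mulrC.
  rewrite !lebesgue_measure_itv/= !lte_fin ltr_pM2r ?invr_gt0// ltrD2r.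
  case: ifP => _; last by rewrite mule0.
  by rewrite -!EFinB -EFinM; congr EFin; field; rewrite gt_eqF.
rewrite /nu ge0_integral_mscale//; congr (_ * _)%E.
by rewrite ge0_integral_pushforward.
Qed.

Lemma ge0_integral_lebesgue_cons n (m : {sigma_finite_measure set (n.-tuple R) -> \bar R})
    (f : n.+1.-tuple R -> \bar R) :
  measurable_fun setT f -> (forall x, 0 <= f x)%E ->
  (\int[lebesgue_cons m]_t f t = \int[mu]_x \int[m]_t f (pair_cons (x, t)))%E.
Proof.
move=> mf f0.
have mfp : measurable_fun setT (fun p : measurableTypeR R * n.-tuple R => f (pair_cons p)).
  by apply: measurableT_comp => //; exact: measurable_pair_cons.
rewrite /= ge0_integral_pushforward//; last exact: measurable_pair_cons.
rewrite preimage_setT.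
exact: (fubini_tonelli1 _ mfp (fun p => f0 _)).
Qed.

(** With the head coordinate innermost, it can be translated by a quantity that depends on the tail.
    This is how the head gets replaced by the sum of all coordinates. *)
Lemma ge0_integral_lebesgue_consC n (m : {sigma_finite_measure set (n.-tuple R) -> \bar R})
    (f : n.+1.-tuple R -> \bar R) :
  measurable_fun setT f -> (forall x, 0 <= f x)%E ->
  (\int[lebesgue_cons m]_t f t = \int[m]_t \int[mu]_x f (pair_cons (x, t)))%E.
Proof.
move=> mf f0.
have mfp : measurable_fun setT (fun p : measurableTypeR R * n.-tuple R => f (pair_cons p)).
  by apply: measurableT_comp => //; exact: measurable_pair_cons.
rewrite ge0_integral_lebesgue_cons//.
exact: (fubini_tonelli _ mfp (fun p => f0 _)).
Qed.

Definition scale_tuple n (s : R) (t : n.-tuple R) : n.-tuple R := map_tuple ( *%R s) t.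

Lemma scale_pair_cons n (s x : R) (t : n.-tuple R) :
  scale_tuple s (pair_cons (x, t)) = pair_cons (s * x, scale_tuple s t).
Proof. exact: val_inj. Qed.

Lemma measurable_scale_tuple n (s : R) : measurable_fun setT (@scale_tuple n s).
Proof.
apply/measurable_fun_tnthP => i.
rewrite (_ : _ \o _ = fun t => s * tnth t i); last first.
  by apply/funext => t /=; rewrite tnth_map.
by apply: measurable_funM => //; exact: measurable_tnth.
Qed.

Lemma ge0_integral_scale_tuple n (s : R) (f : n.-tuple R -> \bar R) : 0 < s ->
  measurable_fun setT f -> (forall x, 0 <= f x)%E ->
  (\int[lebesgue_tuple R n]_t f t =
   (s ^+ n)%:E * \int[lebesgue_tuple R n]_t f (scale_tuple s t))%E.
Proof.
move=> s0; elim: n f => [|n IHn] f mf f0.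
  rewrite expr0 mul1e; apply: eq_integral => t _; congr f.
  by rewrite (tuple0 t) [RHS]tuple0.
have mfs : measurable_fun setT (fun t => f (scale_tuple s t)).
  by apply: measurableT_comp => //; exact: measurable_scale_tuple.
have mpc : measurable_fun setT (fun p : measurableTypeR R * n.-tuple R => f (pair_cons p)).
  by apply: measurableT_comp => //; exact: measurable_pair_cons.
have mF : measurable_fun [set: measurableTypeR R]
    (fun x => \int[lebesgue_tuple R n]_t f (pair_cons (x, t)))%E.
  exact: (measurable_fun_fubini_tonelli_F _ mpc (fun p => f0 _)).
rewrite /= !ge0_integral_lebesgue_cons//.
rewrite (ge0_integral_affine 0 s0 mF); last by move=> x; exact: integral_ge0.
rewrite exprS EFinM -muleA; congr (_ * _)%E.
have mfsc : measurable_fun setT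
    (fun p : measurableTypeR R * n.-tuple R => f (scale_tuple s (pair_cons p))).
  by apply: (measurableT_comp mfs); exact: measurable_pair_cons.
rewrite -[RHS]ge0_integralZl//.
- apply: eq_integral => x _; rewrite addr0 IHn//.
    by congr (_ * _)%E; apply: eq_integral => t _; rewrite scale_pair_cons.
  exact: (measurableT_comp mpc (measurable_pair1 _)).
- exact: (measurable_fun_fubini_tonelli_F _ mfsc (fun p => f0 _)).
- by move=> x _; exact: integral_ge0.
- by rewrite lee_fin exprn_ge0// ltW.
Qed.

End lebesgue_change_of_variables.

(** * Products of gamma laws *)

Section gamma_product.
Context {R : realType}.
Local Notation mu := (@lebesgue_measure R).

Lemma tnth_pair_cons0 n (x : R) (t : n.-tuple R) : tnth (pair_cons (x, t)) ord0 = x.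
Proof. by rewrite /pair_cons tnth0. Qed.

Lemma tnth_pair_consS n (x : R) (t : n.-tuple R) i :
  tnth (pair_cons (x, t)) (lift ord0 i) = tnth t i.
Proof. by rewrite /pair_cons tnthS. Qed.

Definition cons_law (m : probability (measurableTypeR R) R) n
    (m' : probability (n.-tuple R) R) : probability (n.+1.-tuple R) R :=
  law (m \x m')%E (@measurable_pair_cons R n).

(** The recursion is that of [lebesgue_tuple], so that the two measures are compared by a single
    induction when all parameters are positive. *)
Fixpoint gamma_product n : ('I_n -> R) -> probability (n.-tuple R) R :=
  match n with
  | 0 => fun=> dirac [tuple]
  | n'.+1 => fun a => cons_law (gamma_law (a ord0)) (gamma_product (a \o lift ord0))
  end.

Lemma ge0_integral_cons_law (m : probability (measurableTypeR R) R) n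
    (m' : probability (n.-tuple R) R) (f : n.+1.-tuple R -> \bar R) :
  measurable_fun setT f -> (forall t, 0 <= f t)%E ->
  (\int[cons_law m m']_t f t = \int[m]_x \int[m']_t f (pair_cons (x, t)))%E.
Proof.
move=> mf f0; rewrite ge0_integral_law//.
have mfp : measurable_fun setT (fun p : measurableTypeR R * n.-tuple R => f (pair_cons p)).
  by apply: measurableT_comp => //; exact: measurable_pair_cons.
exact: (fubini_tonelli1 _ mfp (fun p => f0 _)).
Qed.

Lemma gamma_product_rectangle n (a : 'I_n -> R) (U : 'I_n -> set R) :
  (forall i, measurable (U i)) ->
  gamma_product a (tuple_rectangle U) = (\prod_(i < n) gamma_law (a i) (U i))%E.
Proof.
elim: n a U => [|n IHn] a U mU.
  by rewrite big_ord0 /= diracE mem_set// => -[].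
rewrite big_ord_recl -[LHS]/(law _ _ _) lawE.
rewrite (_ : _ @^-1` _ = U ord0 `*` tuple_rectangle (U \o lift ord0)); last first.
  apply/seteqP; split=> -[x t] /=.
    move=> Uxt; split; first by have := Uxt ord0; rewrite tnth_pair_cons0.
    by move=> i; have := Uxt (lift ord0 i); rewrite tnth_pair_consS.
  move=> [Ux Ut] i; case: (unliftP ord0 i) => [j|] ->.
    by rewrite tnth_pair_consS; exact: Ut.
  by rewrite tnth_pair_cons0.
have mUt : measurable (tuple_rectangle (U \o lift ord0)).
  by apply: measurable_tuple_rectangle => i; exact: mU.
rewrite -IHn; last by move=> i; exact: mU.
have mU0 : measurable (U ord0 : set (measurableTypeR R)) := mU ord0.
exact: (product_measure1E (gamma_law (a ord0)) (gamma_product (a \o lift ord0)) mU0 mUt).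
Qed.

Lemma ge0_integral_gamma_productS n (a : 'I_n.+1 -> R) (f : n.+1.-tuple R -> \bar R) :
  measurable_fun setT f -> (forall t, 0 <= f t)%E ->
  (\int[gamma_product a]_t f t =
   \int[gamma_law (a ord0)]_x
     \int[gamma_product (fun i => a (lift ord0 i))]_t f (pair_cons (x, t)))%E.
Proof. exact: ge0_integral_cons_law. Qed.

Lemma ge0_integral_gamma_product n (a : 'I_n -> R) (f : n.-tuple R -> \bar R) :
  (forall i, 0 < a i) -> measurable_fun setT f -> (forall t, 0 <= f t)%E ->
  (\int[gamma_product a]_t f t =
   \int[lebesgue_tuple R n]_t
     (f t * (\prod_(i < n) gamma_density (a i) (tnth t i))%:E))%E.
Proof.
elim: n a f => [|n IHn] a f a0 mf f0.
  by apply: eq_integral => t _; rewrite big_ord0 mule1.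
have mprod m (b : 'I_m -> R) : measurable_fun setT
    (fun t : m.-tuple R => \prod_(i < m) gamma_density (b i) (tnth t i)).
  apply: measurable_prod => i _.
  by apply: (measurableT_comp (measurable_gamma_density (b i))); exact: measurable_tnth.
have prod0 m (b : 'I_m -> R) (t : m.-tuple R) : (forall i, 0 < b i) ->
    0 <= \prod_(i < m) gamma_density (b i) (tnth t i).
  by move=> b0; apply: prodr_ge0 => i _; rewrite gamma_density_ge0.
have mfp : measurable_fun setT (fun p : measurableTypeR R * n.-tuple R => f (pair_cons p)).
  by apply: measurableT_comp => //; exact: measurable_pair_cons.
have mfx x : measurable_fun setT (fun t : n.-tuple R => f (pair_cons (x, t))).
  exact: (measurableT_comp mfp (measurable_pair1 _)).
rewrite [LHS]ge0_integral_gamma_productS// ge0_integral_gamma_law//; first last.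
- by move=> x; exact: integral_ge0.
- exact: (measurable_fun_fubini_tonelli_F _ mfp (fun p => f0 _)).
rewrite [RHS]ge0_integral_lebesgue_cons//; first last.
- by move=> t; rewrite mule_ge0// lee_fin prod0.
- by apply: emeasurable_funM => //; apply/measurable_EFinP; exact: mprod.
apply: eq_integral => x _.
rewrite IHn//.
rewrite -[LHS]ge0_integralZr//.
- apply: eq_integral => t _; rewrite -muleA -EFinM big_ord_recl tnth_pair_cons0.
  congr (_ * _%:E)%E; rewrite mulrC; congr (_ * _).
  by apply: eq_bigr => i _; rewrite tnth_pair_consS.
- by apply: emeasurable_funM => //; apply/measurable_EFinP; exact: mprod.
- by move=> t _; rewrite mule_ge0// lee_fin prod0// => i; exact: a0.
- by rewrite lee_fin gamma_density_ge0.
Qed.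

(** [gamma_law_expn] in each coordinate, by Tonelli. Keeping the Pochhammer symbols as factors on
    the left, instead of dividing by them, gives a form that is valid when some [a i] is 0. *)
Lemma gamma_product_expn n (a : 'I_n -> R) (b : 'I_n -> nat) (f : n.-tuple R -> \bar R) :
  (forall i, 0 <= a i) -> measurable_fun setT f -> (forall t, 0 <= f t)%E ->
  ((\prod_(i < n) pochhammer (a i) (b i))%:E *
     \int[gamma_product (fun i => a i + (b i)%:R)%R]_t f t =
   \int[gamma_product a]_t (f t * (\prod_(i < n) `|tnth t i| ^+ b i)%:E))%E.
Proof.
elim: n a b f => [|n IHn] a b f a0 mf f0.
  rewrite big_ord0 mul1e; apply: eq_integral => t _.
  by rewrite big_ord0 mule1.
have mprod m (c : 'I_m -> nat) : measurable_fun setT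
    (fun t : m.-tuple R => \prod_(i < m) `|tnth t i| ^+ c i).
  apply: measurable_prod => i _; apply: measurable_funX.
  by apply: measurableT_comp => //; exact: measurable_tnth.
have prod0 m (c : 'I_m -> nat) (t : m.-tuple R) :
    0 <= \prod_(i < m) `|tnth t i| ^+ c i.
  by apply: prodr_ge0 => i _; rewrite exprn_ge0.
have mfp : measurable_fun setT (fun p : measurableTypeR R * n.-tuple R => f (pair_cons p)).
  by apply: measurableT_comp => //; exact: measurable_pair_cons.
have mfx x : measurable_fun setT (fun t : n.-tuple R => f (pair_cons (x, t))).
  exact: (measurableT_comp mfp (measurable_pair1 _)).
have P0 : 0 <= \prod_(i < n) pochhammer (a (lift ord0 i)) (b (lift ord0 i)).
  apply: prodr_ge0 => i _; elim: (b _) => //= m IHm.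
  by rewrite mulr_ge0// addr_ge0.
pose c i := a (lift ord0 i) + (b (lift ord0 i))%:R.
have mF : measurable_fun [set: measurableTypeR R]
    (fun x => \int[gamma_product c]_t f (pair_cons (x, t)))%E.
  exact: (measurable_fun_fubini_tonelli_F _ mfp (fun p => f0 _)).
have F0 x : (0 <= \int[gamma_product c]_t f (pair_cons (x, t)))%E by exact: integral_ge0.
rewrite [X in (_ * X)%E]ge0_integral_gamma_productS//.
rewrite [RHS]ge0_integral_gamma_productS//; first last.
- by move=> t; rewrite mule_ge0// lee_fin.
- by apply: emeasurable_funM => //; apply/measurable_EFinP; exact: mprod.
rewrite big_ord_recl mulrC EFinM -muleA.
rewrite [X in (_ * X)%E](gamma_law_expn (b ord0) (a0 ord0) mF F0).
rewrite -[LHS]ge0_integralZl//; first last.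
- by move=> x _; rewrite mule_ge0// lee_fin exprn_ge0.
- apply: emeasurable_funM => //; apply/measurable_EFinP.
  by apply: (@measurable_funX _ _ _ _ (fun x : measurableTypeR R => `|x|));
    exact: normr_measurable.
apply: eq_integral => x _; rewrite muleA IHn//.
rewrite -[LHS]ge0_integralZr//.
- apply: eq_integral => t _; rewrite -muleA -EFinM big_ord_recl tnth_pair_cons0.
  congr (_ * _%:E)%E; rewrite mulrC; congr (_ * _).
  by apply: eq_bigr => i _; rewrite tnth_pair_consS.
- by apply: emeasurable_funM => //; apply/measurable_EFinP; exact: mprod.
- by move=> t _; rewrite mule_ge0// lee_fin.
Qed.

(** Every gamma law is carried by the nonnegative half-line. This removes the absolute values above
    and allows identities on directions that fail for coordinates of mixed signs. *)
Lemma gamma_product_eq_integral n (a : 'I_n -> R) (f g : n.-tuple R -> \bar R) :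
  measurable_fun setT f -> measurable_fun setT g ->
  (forall t, (forall i, 0 <= tnth t i) -> f t = g t) ->
  (\int[gamma_product a]_t f t = \int[gamma_product a]_t g t)%E.
Proof.
move=> mf mg fg; apply: ae_eq_integral => //.
pose N : set (n.-tuple R) := tuple_rectangle (fun=> `[0, +oo[%classic : set R).
have mN : measurable N by apply: measurable_tuple_rectangle => i; exact: measurable_itv.
exists (~` N); split; first exact: measurableC.
  transitivity (1 - gamma_product a N)%E; first exact: probability_setC.
  rewrite gamma_product_rectangle// big1 ?subee// => i _.
  exact: gamma_law_itv0y.
move=> t /= nfg Nt; apply: nfg => _; apply: fg => i.
by have := Nt i; rewrite /= in_itv/= andbT.
Qed.

End gamma_product.

(** * Dirichlet laws as normalized gamma products *)

Section gamma_dirichlet.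
Context {R : realType}.
Local Notation mu := (@lebesgue_measure R).

Definition tuple_sum n (t : n.-tuple R) : R := \sum_(i < n) tnth t i.

Definition normalize_tuple n (t : n.-tuple R) : n.-tuple R :=
  scale_tuple (tuple_sum t)^-1 t.

Lemma measurable_tuple_sum n : measurable_fun setT (@tuple_sum n).
Proof. by apply: measurable_sum => i; exact: measurable_tnth. Qed.

(** Inversion is not continuous at 0, so it is written piecewise through the measurable power of
    exponent -1. *)
Lemma measurable_invr : measurable_fun [set: R] (@GRing.inv R).
Proof.
rewrite (_ : @GRing.inv R =
    fun x => if 0 <= x then x `^ (-1) else - ((- x) `^ (-1))); last first.
  apply/funext => x; case: leP => x0; first by rewrite powR_inv1.
  by rewrite powR_inv1 ?invrN ?opprK// oppr_ge0 ltW.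
apply: measurable_fun_ifT; first exact: measurable_fun_ler.
  exact: measurable_powR.
apply: measurableT_comp => //.
by apply: (measurableT_comp (measurable_powR _)).
Qed.

Lemma measurable_normalize_tuple n : measurable_fun setT (@normalize_tuple n).
Proof.
apply/measurable_fun_tnthP => i.
rewrite (_ : _ \o _ = fun t => (tuple_sum t)^-1 * tnth t i); last first.
  by apply/funext => t /=; rewrite tnth_map.
apply: measurable_funM; last exact: measurable_tnth.
by apply: (measurableT_comp measurable_invr); exact: measurable_tuple_sum.
Qed.

Lemma tuple_sum_pair_cons n x (t : n.-tuple R) :
  tuple_sum (pair_cons (x, t)) = x + tuple_sum t.
Proof.
rewrite /tuple_sum big_ord_recl tnth_pair_cons0; congr (_ + _).
by apply: eq_bigr => i _; rewrite tnth_pair_consS.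
Qed.

Lemma tuple_sum_scale n s (t : n.-tuple R) :
  tuple_sum (scale_tuple s t) = s * tuple_sum t.
Proof. by rewrite /tuple_sum mulr_sumr; apply: eq_bigr => i _; rewrite tnth_map. Qed.

Lemma scale_tuple_comp n s s' (t : n.-tuple R) :
  scale_tuple s (scale_tuple s' t) = scale_tuple (s * s') t.
Proof. by apply: eq_from_tnth => i; rewrite !tnth_map mulrA. Qed.

Lemma scale_tuple1 n (t : n.-tuple R) : scale_tuple 1 t = t.
Proof. by apply: eq_from_tnth => i; rewrite !tnth_map mul1r. Qed.

Lemma add_coord0E n (t : n.-tuple R) : add_coord0 t = pair_cons (1 - tuple_sum t, t).
Proof. by []. Qed.

Lemma tuple_sum_add_coord0 n (t : n.-tuple R) : tuple_sum (add_coord0 t) = 1.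
Proof. by rewrite add_coord0E tuple_sum_pair_cons subrK. Qed.

Lemma measurable_add_coord0 n : measurable_fun setT (@add_coord0 R n).
Proof.
apply: (@measurable_cons _ _ (n.-tuple R) R (fun t => 1 - tuple_sum t) n id) => //.
by apply: measurable_funB => //; exact: measurable_tuple_sum.
Qed.

Lemma measurable_open_simplex n : measurable (@open_simplex R n).
Proof.
rewrite (_ : @open_simplex R n = tuple_rectangle (fun=> `]0, +oo[%classic : set R) `&`
    (@tuple_sum n @^-1` `]-oo, 1[%classic)); last first.
  apply/seteqP; split=> t; rewrite /= !in_itv/=.
    by move=> [t0 t1]; split=> // i /=; rewrite in_itv/= andbT.
  by move=> [t0 t1]; split=> // i; have := t0 i; rewrite /= in_itv/= andbT.
apply: measurableI.
  by apply: measurable_tuple_rectangle => i; exact: measurable_itv.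
rewrite -[X in measurable X]setTI; apply: measurable_tuple_sum => //.
Qed.

Definition dirichlet_density n (a : 'I_n.+1 -> R) (t : n.-tuple R) : R :=
  gamma (\sum_(i < n.+1) a i) / \prod_(i < n.+1) gamma (a i) *
  (1 - \sum_(i < n) tnth t i) `^ (a ord0 - 1) *
  \prod_(i < n) (tnth t i) `^ (a (lift ord0 i) - 1).

Lemma powR_sum (s : R) (I : Type) (r : seq I) (b : I -> R) : 0 < s ->
  \prod_(i <- r) s `^ b i = s `^ (\sum_(i <- r) b i).
Proof.
move=> s0; symmetry; apply: (big_morph (powR s)); last exact: powRr0.
by move=> x y; rewrite powRD// (gt_eqF s0) implybT.
Qed.

Lemma expR_sum (I : Type) (r : seq I) (b : I -> R) :
  \prod_(i <- r) expR (b i) = expR (\sum_(i <- r) b i).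
Proof.
by symmetry; apply: (big_morph expR); [exact: expRD|exact: expR0].
Qed.

(* The density identity behind the independence of the sum and the direction;
   [s ^+ n] is the Jacobian of [t |-> s *: t]. *)
Lemma prod_gamma_density n (a : 'I_n.+1 -> R) (s : R) (t : n.-tuple R) :
  (forall i, 0 < a i) -> 0 < s ->
  s ^+ n * \prod_(i < n.+1) gamma_density (a i) (tnth (scale_tuple s (add_coord0 t)) i) =
  gamma_density (\sum_(i < n.+1) a i) s *
    (if t \in @open_simplex R n then dirichlet_density a t else 0).
Proof.
move=> a0 s0.
have sa0 : 0 < \sum_(i < n.+1) a i.
  by rewrite big_ord_recl ltr_wpDr// sumr_ge0// => i _; rewrite ltW.
under eq_bigr do rewrite tnth_map.
case: ifPn => [|]; last first.
  rewrite notin_setE => nt; rewrite mulr0.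
  (* Outside the open simplex some coordinate is nonpositive, and its gamma density already vanishes
     there. *)
  suff [i yi] : exists i, tnth (add_coord0 t) i <= 0.
    rewrite (bigD1 i)//= gamma_density_eq0 ?mul0r ?mulr0//.
    by rewrite pmulr_rle0.
  apply: contrapT => /forallNP y0; apply: nt; split.
    move=> i; have := y0 (lift ord0 i).
    by rewrite add_coord0E tnth_pair_consS => /negP; rewrite -ltNge.
  have := y0 ord0.
  by rewrite add_coord0E tnth_pair_cons0 => /negP; rewrite -ltNge subr_gt0.
rewrite inE => -[t0 t1].
have y0 i : 0 < tnth (add_coord0 t) i.
  case: (unliftP ord0 i) => [j|] ->; rewrite add_coord0E.
    by rewrite tnth_pair_consS.
  by rewrite tnth_pair_cons0 subr_gt0.
rewrite /gamma_density /gamma_integrand s0.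
under eq_bigr => i _ do rewrite mulr_gt0 ?y0// powRM ?ltW//.
rewrite !big_split/= powR_sum// expR_sum.
have -> : \sum_(i < n.+1) - (s * tnth (add_coord0 t) i) = - s.
  by rewrite sumrN -mulr_sumr -/(tuple_sum _) tuple_sum_add_coord0 mulr1.
have -> : s ^+ n * (s `^ (\sum_(i < n.+1) (a i - 1)) *
    \prod_(i < n.+1) tnth (add_coord0 t) i `^ (a i - 1) * expR (- s) *
    \prod_(i < n.+1) (gamma (a i))^-1) = s `^ (\sum_(i < n.+1) a i - 1) * expR (- s) *
    (\prod_(i < n.+1) tnth (add_coord0 t) i `^ (a i - 1) / \prod_(i < n.+1) gamma (a i)).
  (* The [n.+1] exponents lose [n.+1] units and the Jacobian restores [n], which leaves exactly the
     exponent of the gamma density of the sum. *)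
  have -> : \sum_(i < n.+1) a i - 1 = n%:R + \sum_(i < n.+1) (a i - 1).
    by rewrite sumrB sumr_const card_ord -natr1; ring.
  by rewrite powRD ?(gt_eqF s0) ?implybT// powR_mulrn ?ltW// prodfV; ring.
have -> : \prod_(i < n.+1) tnth (add_coord0 t) i `^ (a i - 1) =
    (1 - tuple_sum t) `^ (a ord0 - 1) * \prod_(i < n) tnth t i `^ (a (lift ord0 i) - 1).
  rewrite big_ord_recl add_coord0E tnth_pair_cons0; congr (_ * _).
  by apply: eq_bigr => i _; rewrite tnth_pair_consS.
rewrite /dirichlet_density -/(tuple_sum t).
have G0 : gamma (\sum_(i < n.+1) a i) != 0 by rewrite gt_eqF ?gamma_gt0.
have P0 : \prod_(i < n.+1) gamma (a i) != 0.
  by rewrite gt_eqF// prodr_gt0// => i _; rewrite gamma_gt0.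
by field; rewrite G0 P0.
Qed.

Lemma dirichlet_density_ge0 n (a : 'I_n.+1 -> R) t : (forall i, 0 < a i) ->
  0 <= dirichlet_density a t.
Proof.
move=> a0; rewrite /dirichlet_density !mulr_ge0 ?powR_ge0 ?invr_ge0//.
- rewrite ltW// gamma_gt0// big_ord_recl ltr_wpDr// sumr_ge0// => i _.
  by rewrite ltW.
- by apply: prodr_ge0 => i _; rewrite ltW// gamma_gt0.
- by apply: prodr_ge0 => i _; rewrite powR_ge0.
Qed.

Lemma measurable_dirichlet_density n (a : 'I_n.+1 -> R) :
  measurable_fun setT (dirichlet_density a).
Proof.
apply: measurable_funM; last first.
  apply: measurable_prod => i _.
  by apply: (measurableT_comp (measurable_powR _)); exact: measurable_tnth.
apply: measurable_funM => //.
apply: (measurableT_comp (measurable_powR _)).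
by apply: measurable_funB => //; exact: measurable_tuple_sum.
Qed.

(** The change of variables has two steps. For a fixed tail the head is translated so as to become
    the sum [s]; then, for a fixed [s], the tail is scaled by [s]. After that the joint density
    splits into a function of [s] and a function of the direction. *)
Lemma gamma_product_sum_normalize n (a : 'I_n.+1 -> R)
    (A : set R) (U : set (n.+1.-tuple R)) :
  (forall i, 0 < a i) -> measurable A -> measurable U ->
  gamma_product a (@tuple_sum n.+1 @^-1` A `&` @normalize_tuple n.+1 @^-1` U) =
  (gamma_law (\sum_(i < n.+1) a i)%R A * dirichlet_pos a U)%E.
Proof.
move=> a0 mA mU; set E := _ `&` _.
have sa0 : 0 < \sum_(i < n.+1) a i.
  by rewrite big_ord_recl ltr_wpDr// sumr_ge0// => i _; rewrite ltW.
have mE : measurable E.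
  apply: measurableI; rewrite -[X in measurable X]setTI.
    exact: measurable_tuple_sum.
  exact: measurable_normalize_tuple.
pose H (t : n.+1.-tuple R) : R :=
  \1_E t * \prod_(i < n.+1) gamma_density (a i) (tnth t i).
have H0 t : 0 <= H t.
  by rewrite mulr_ge0// prodr_ge0// => i _; rewrite gamma_density_ge0.
have mH : measurable_fun setT (fun t => (H t)%:E).
  apply/measurable_EFinP; apply: measurable_funM => //.
  apply: measurable_prod => i _.
  by apply: (measurableT_comp (measurable_gamma_density (a i))); exact: measurable_tnth.
(* [K (t, s)] is the tuple of tail [t] and sum [s]. The factor 1 is the slope that
   [ge0_integral_affine] expects. *)
pose K (p : n.-tuple R * measurableTypeR R) : n.+1.-tuple R :=
  pair_cons (1 * p.2 - tuple_sum p.1, p.1).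
have mK : measurable_fun setT K.
  apply: (@measurable_cons _ _ _ R (fun p : n.-tuple R * measurableTypeR R =>
    1 * p.2 - tuple_sum p.1) n fst) => //.
  apply: measurable_funB; first by apply: measurable_funM => //; exact: measurable_snd.
  by apply: (measurableT_comp (@measurable_tuple_sum n)); exact: measurable_fst.
have mHK : measurable_fun setT (fun p => (H (K p))%:E) by exact: measurableT_comp mH mK.
transitivity (\int[mu]_s \int[lebesgue_tuple R n]_t (H (K (t, s)))%:E)%E.
  transitivity (\int[gamma_product a]_t (\1_E t)%:E)%E.
    by rewrite integral_indic// setIT.
  rewrite ge0_integral_gamma_product//; last first.
    by apply/measurable_EFinP; exact: measurable_indic.
  under eq_integral => t _ do rewrite -EFinM -/(H t).
  rewrite [LHS]ge0_integral_lebesgue_consC//.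
  have HK0 p : (0 <= (H (K p))%:E)%E by rewrite lee_fin.
  apply: etrans (fubini_tonelli (m1 := lebesgue_tuple R n) (m2 := mu) _ mHK HK0).
  apply: eq_integral => t _.
  rewrite (ge0_integral_affine (- tuple_sum t) ltr01) ?mul1e//.
  have mpc : measurable_fun setT
      (fun x : measurableTypeR R => pair_cons (x, t)).
    exact: (measurableT_comp (@measurable_pair_cons R n) (measurable_pair2 _)).
    exact: (measurableT_comp mH mpc).
  by move=> x; rewrite lee_fin.
have mgA : measurable_fun [set: measurableTypeR R]
    (fun s => (\1_A s * gamma_density (\sum_(i < n.+1) a i) s)%:E).
  apply/measurable_EFinP; apply: measurable_funM; last exact: measurable_gamma_density.
  exact: measurable_indic.
transitivity (\int[mu]_s ((\1_A s * gamma_density (\sum_(i < n.+1) a i) s)%:E *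
    dirichlet_pos a U))%E; last first.
  rewrite ge0_integralZr//.
  - congr (_ * _)%E.
    transitivity (\int[gamma_law (\sum_(i < n.+1) a i)]_s (\1_A s)%:E)%E.
      rewrite ge0_integral_gamma_law//.
      by apply/measurable_EFinP; exact: measurable_indic.
    by rewrite integral_indic// setIT.
  - by move=> s _; rewrite lee_fin mulr_ge0// gamma_density_ge0.
  - by apply: integral_ge0 => t _; rewrite lee_fin dirichlet_density_ge0.
apply: eq_integral => s _.
(* A tuple of sum [s <= 0] has a nonpositive coordinate, so the joint density vanishes and only
   [s > 0] remains to be scaled. *)
have [s0|s0] := leP s 0.
  rewrite gamma_density_eq0// mulr0 mul0e integral0_eq// => t _.
  suff [i Ki] : exists i, tnth (K (t, s)) i <= 0.
    by rewrite /H (bigD1 i)//= gamma_density_eq0// mul0r mulr0.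
  apply: contrapT => /forallNP K0.
  have : 0 < tuple_sum (K (t, s)).
    rewrite /tuple_sum big_ord_recl; apply: ltr_pwDl.
      by rewrite ltNge; apply/negP/K0.
    by apply: sumr_ge0 => i _; rewrite leNgt; apply/negP => /ltW; exact: K0.
  by rewrite tuple_sum_pair_cons subrK mul1r ltNge s0.
have mHs : measurable_fun setT (fun t => (H (K (t, s)))%:E).
  exact: (measurableT_comp mHK (measurable_pair2 _)).
rewrite (ge0_integral_scale_tuple s0 mHs); last by move=> t; rewrite lee_fin.
rewrite -[LHS]ge0_integralZl//; first last.
- by rewrite lee_fin exprn_ge0// ltW.
- by move=> t _; rewrite lee_fin.
- exact: (measurableT_comp mHs (measurable_scale_tuple _)).
rewrite /dirichlet_pos [in RHS]integral_mkcond -[RHS]ge0_integralZl//; first last.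
- by rewrite lee_fin mulr_ge0// gamma_density_ge0.
- move=> t _; rewrite patchE; case: ifP => // _.
  by rewrite lee_fin dirichlet_density_ge0.
- apply/(measurable_restrictT _ _).1.
    apply: measurableI; first exact: measurable_open_simplex.
    by rewrite -[X in measurable X]setTI; exact: measurable_add_coord0.
  by apply: measurable_funTS; apply/measurable_EFinP; exact: measurable_dirichlet_density.
apply: eq_integral => t _.
have -> : K (scale_tuple s t, s) = scale_tuple s (add_coord0 t).
  by rewrite add_coord0E scale_pair_cons /K /= tuple_sum_scale mul1r mulrBr mulr1.
have Es : \1_E (scale_tuple s (add_coord0 t)) = \1_A s * \1_U (add_coord0 t) :> R.
  rewrite !indicE -natrM mulnb; congr (_%:R); congr nat_of_bool.
  rewrite in_setI; congr (_ && _); apply/idP/idP; rewrite !inE /=.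
  - by rewrite tuple_sum_scale tuple_sum_add_coord0 mulr1.
  - by rewrite tuple_sum_scale tuple_sum_add_coord0 mulr1.
  - rewrite /normalize_tuple tuple_sum_scale tuple_sum_add_coord0 mulr1.
    by rewrite scale_tuple_comp mulVf ?gt_eqF// scale_tuple1.
  - rewrite /normalize_tuple tuple_sum_scale tuple_sum_add_coord0 mulr1.
    by rewrite scale_tuple_comp mulVf ?gt_eqF// scale_tuple1.
have inS : (t \in @open_simplex R n `&` @add_coord0 R n @^-1` U) =
    (t \in @open_simplex R n) && (add_coord0 t \in U).
  by apply/idP/andP => [/set_mem[tS tU]|[/set_mem tS /set_mem tU]]; [split|]; apply/mem_set.
rewrite -EFinM /H Es mulrCA prod_gamma_density// patchE inS !indicE.
case: (t \in _) => /=; last by rewrite !mulr0 mule0.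
case: (_ \in U); last by rewrite mulr0 !mul0r mule0.
by rewrite mulr1 mulrA EFinM.
Qed.

End gamma_dirichlet.

(** * Convolution of gamma laws and the beta law as the law of a ratio *)

Section gamma_consequences.
Context {R : realType}.
Local Notation mu := (@lebesgue_measure R).

Lemma dirichlet_pos_gamma_product n (a : 'I_n.+1 -> R) (U : set (n.+1.-tuple R)) :
  (forall i, 0 < a i) -> measurable U ->
  dirichlet_pos a U = gamma_product a (@normalize_tuple R n.+1 @^-1` U).
Proof.
move=> a0 mU.
have := gamma_product_sum_normalize a0 measurableT mU.
rewrite preimage_setT setTI => ->.
rewrite [X in (X * _)%E](_ : _ = 1%E) ?mul1e//.
exact: (probability_setT (gamma_law _)).
Qed.

(** All directions are allowed, and [dirichlet_pos] has total mass 1 because it is an image of a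
    probability. *)
Lemma gamma_product_sum n (a : 'I_n.+1 -> R) (A : set R) :
  (forall i, 0 < a i) -> measurable A ->
  gamma_product a (@tuple_sum R n.+1 @^-1` A) = gamma_law (\sum_(i < n.+1) a i) A.
Proof.
move=> a0 mA.
have := gamma_product_sum_normalize a0 mA measurableT.
rewrite preimage_setT setIT => ->.
rewrite dirichlet_pos_gamma_product// preimage_setT.
by rewrite [X in (_ * X)%E](_ : _ = 1%E) ?mule1//; exact: probability_setT.
Qed.

Definition pair_params (p q : R) : 'I_2 -> R := fun i => if i == ord0 then p else q.

Definition pair_tuple (z : measurableTypeR R * measurableTypeR R) : 2.-tuple R :=
  pair_cons (z.1, pair_cons (z.2, [tuple])).

Lemma measurable_pair_tuple : measurable_fun setT pair_tuple.
Proof.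
apply: (@measurable_cons _ _ _ R fst 1 (fun z => pair_cons (z.2, [tuple]))).
  exact: measurable_fst.
exact: (@measurable_cons _ _ _ R snd 0 (fun z => [tuple])).
Qed.

Lemma gamma_product_pair (p q : R) (V : set (2.-tuple R)) : measurable V ->
  gamma_product (pair_params p q) V = (gamma_law p \x gamma_law q)%E (pair_tuple @^-1` V).
Proof.
move=> mV; rewrite -[RHS](lawE _ measurable_pair_tuple).
apply: (probability_eq_on_tuple_rectangles (m := gamma_product (pair_params p q))
  (m' := law (gamma_law p \x gamma_law q)%E measurable_pair_tuple)) => //.
move=> U mU; rewrite gamma_product_rectangle// lawE.
have -> : pair_tuple @^-1` tuple_rectangle U = U ord0 `*` U (lift ord0 ord0).
  apply/seteqP; split=> -[x y] /=.
    move=> Uxy; split; first by have := Uxy ord0; rewrite tnth_pair_cons0.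
    by have := Uxy (lift ord0 ord0); rewrite tnth_pair_consS tnth_pair_cons0.
  move=> [Ux Uy] i; case: (unliftP ord0 i) => [j|] ->; last by rewrite tnth_pair_cons0.
  by rewrite (ord1 j) tnth_pair_consS tnth_pair_cons0.
rewrite big_ord_recl big_ord_recl big_ord0 mule1; symmetry.
have mU0 : measurable (U ord0 : set (measurableTypeR R)) := mU ord0.
have mU1 : measurable (U (lift ord0 ord0) : set (measurableTypeR R)) := mU _.
exact: (product_measure1E (gamma_law p) (gamma_law q) mU0 mU1).
Qed.

Lemma pair_params_gt0 (p q : R) : 0 < p -> 0 < q -> forall i, 0 < pair_params p q i.
Proof. by move=> p0 q0 i; rewrite /pair_params; case: ifP. Qed.

Lemma tuple_sum_pair_tuple z : tuple_sum (pair_tuple z) = z.1 + z.2.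
Proof. by rewrite !tuple_sum_pair_cons /tuple_sum big_ord0 addr0. Qed.

(** For positive parameters this is the law of the sum of a pair, read on the ordinary product. A
    parameter 0 contributes the Dirac mass at 0, which is neutral for convolution. *)
Lemma ge0_integral_gamma_law_add (p q : R) (f : measurableTypeR R -> \bar R) :
  0 <= p -> 0 <= q -> measurable_fun setT f -> (forall x, 0 <= f x)%E ->
  (\int[gamma_law p]_x \int[gamma_law q]_y f (x + y)%R = \int[gamma_law (p + q)%R]_x f x)%E.
Proof.
move=> + + mf f0.
have mS : measurable_fun setT
    (fun z : measurableTypeR R * measurableTypeR R => z.1 + z.2 : measurableTypeR R).
  apply: measurable_funD; [exact: measurable_fst|exact: measurable_snd].
have mfS : measurable_fun setT
    (fun z : measurableTypeR R * measurableTypeR R => f (z.1 + z.2)).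
  exact: measurableT_comp mf mS.
have mfSF : measurable_fun [set: measurableTypeR R]
    (fun x => \int[gamma_law q]_y f (x + y)%R)%E.
  exact: (measurable_fun_fubini_tonelli_F _ mfS (fun z => f0 _)).
rewrite le_eqVlt => /predU1P[<- _|p0].
  rewrite add0r [LHS](ge0_integral_gamma_law0 (lexx _) mfSF).
  by apply: eq_integral => y _; rewrite add0r.
rewrite le_eqVlt => /predU1P[<-|q0].
  rewrite addr0; apply: eq_integral => x _.
  rewrite [LHS](ge0_integral_gamma_law0 (lexx _)) ?addr0//.
  exact: (measurableT_comp mfS (measurable_pair1 _)).
transitivity (\int[law (gamma_law p \x gamma_law q)%E mS]_x f x)%E.
  rewrite ge0_integral_law//; symmetry.
  exact: (fubini_tonelli1 _ mfS (fun z => f0 _)).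
apply: eq_measure_integral => A mA _.
have := gamma_product_sum (pair_params_gt0 p0 q0) mA.
have -> : \sum_(i < 2) pair_params p q i = p + q by rewrite big_ord_recl big_ord1.
rewrite gamma_product_pair; last first.
  by rewrite -[X in measurable X]setTI; exact: measurable_tuple_sum.
have -> : pair_tuple @^-1` (@tuple_sum R 2 @^-1` A) = (fun z => z.1 + z.2) @^-1` A.
  by apply/seteqP; split=> z /=; rewrite tuple_sum_pair_tuple.
exact.
Qed.

Lemma beta_law_gamma_law (p q : R) (U : set R) : 0 < p -> 0 < q -> measurable U ->
  beta_law p q U =
  (gamma_law q \x gamma_law p)%E [set z | U (z.2 / (z.1 + z.2))].
Proof.
move=> p0 q0 mU.
pose V : set (2.-tuple R) := (@tnth 2 R)^~ (lift ord0 ord0) @^-1` U.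
have mV : measurable V by rewrite -[X in measurable X]setTI; exact: measurable_tnth.
(* [D(q, p)] is integrated in its coordinate 1, which carries [p], while coordinate 0 is [1 - x] and
   carries [q]: hence the exchange of the two parameters. *)
transitivity (dirichlet_pos (pair_params q p) V); last first.
  rewrite dirichlet_pos_gamma_product//; last exact: pair_params_gt0.
  rewrite gamma_product_pair; last first.
    by rewrite -[X in measurable X]setTI; exact: measurable_normalize_tuple.
  congr ((_ \x _)%E _); apply/seteqP; split=> z /=;
    by rewrite /V /= tnth_map tuple_sum_pair_tuple tnth_pair_consS tnth_pair_cons0 mulrC.
have mD : measurable (@open_simplex R 1 `&` @add_coord0 R 1 @^-1` V).
  apply: measurableI; first exact: measurable_open_simplex.
  by rewrite -[X in measurable X]setTI; exact: measurable_add_coord0.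
have mR : measurable_fun setT ((fun t => (dirichlet_density (pair_params q p) t)%:E)
    \_ (@open_simplex R 1 `&` @add_coord0 R 1 @^-1` V)).
  apply/(measurable_restrictT _ _).1 => //.
  by apply: measurable_funTS; apply/measurable_EFinP; exact: measurable_dirichlet_density.
rewrite /dirichlet_pos [RHS]integral_mkcond [RHS]ge0_integral_lebesgue_cons//; last first.
  move=> t; rewrite patchE; case: ifP => // _.
  rewrite lee_fin; apply: dirichlet_density_ge0; exact: pair_params_gt0.
rewrite /beta_law integral_mkcond; apply: eq_integral => x _.
rewrite [RHS]integral_dirac//; last first.
  apply: (measurableT_comp mR).
  exact: (measurableT_comp (@measurable_pair_cons R 0) (measurable_pair1 _)).
rewrite diracT mul1e !patchE.
rewrite (_ : (pair_cons (x, [tuple]) \in _) = (x \in `]0%R, 1%R[%classic `&` U)); last first.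
  apply/idP/idP => /set_mem /= [].
  + move=> [t0 t1] Ux; apply/mem_set; split.
      rewrite /= in_itv/=; have := t0 ord0; rewrite tnth_pair_cons0 => ->.
      by move: t1; rewrite big_ord1 tnth_pair_cons0.
    by move: Ux; rewrite /V/= add_coord0E tnth_pair_consS tnth_pair_cons0.
  + rewrite in_itv/= => /andP[x0 x1] Ux; apply/mem_set; split.
      split=> [i|]; first by rewrite (ord1 i) tnth_pair_cons0.
      by rewrite big_ord1 tnth_pair_cons0.
    by rewrite /V/= add_coord0E tnth_pair_consS tnth_pair_cons0.
case: ifP => // _; congr (_%:E).
have -> : \sum_(i < 2) pair_params q p i = p + q.
  by rewrite big_ord_recl big_ord1 addrC.
have -> : \prod_(i < 2) gamma (pair_params q p i) = gamma p * gamma q.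
  by rewrite big_ord_recl big_ord1 mulrC.
rewrite !big_ord1 tnth_pair_cons0; exact: mulrAC.
Qed.

End gamma_consequences.

(** * Sums of independent gamma tuples *)

Section tuple_convolution.
Context {R : realType}.

Definition add_tuple n (x z : n.-tuple R) : n.-tuple R :=
  [tuple tnth x i + tnth z i | i < n].

Lemma add_pair_cons n (x z : R) (s t : n.-tuple R) :
  add_tuple (pair_cons (x, s)) (pair_cons (z, t)) = pair_cons (x + z, add_tuple s t).
Proof.
apply: eq_from_tnth => i; rewrite tnth_mktuple.
case: (unliftP ord0 i) => [j|] ->; last by rewrite !tnth_pair_cons0.
by rewrite !tnth_pair_consS tnth_mktuple.
Qed.

Lemma measurable_add_tuple n :
  measurable_fun setT (fun p : n.-tuple R * n.-tuple R => add_tuple p.1 p.2).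
Proof.
apply/measurable_fun_tnthP => i.
rewrite (_ : _ \o _ = fun p : n.-tuple R * n.-tuple R => tnth p.1 i + tnth p.2 i).
  apply: measurable_funD.
    by apply: (measurableT_comp (measurable_tnth i)); exact: measurable_fst.
  by apply: (measurableT_comp (measurable_tnth i)); exact: measurable_snd.
by apply/funext => p /=; rewrite tnth_mktuple.
Qed.

(** Induction on the coordinates, the heads being added by the one-dimensional convolution. Peeling
    both tuples leaves the tail of the first between the two heads, so one exchange of integrals is
    required. *)
Lemma ge0_integral_gamma_product_add n (a b : 'I_n -> R) (f : n.-tuple R -> \bar R) :
  (forall i, 0 <= a i) -> (forall i, 0 <= b i) ->
  measurable_fun setT f -> (forall t, 0 <= f t)%E ->
  (\int[gamma_product a]_x \int[gamma_product b]_z f (add_tuple x z) =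
   \int[gamma_product (fun i => a i + b i)%R]_t f t)%E.
Proof.
elim: n a b f => [|n IHn] a b f a0 b0 mf f0.
  have int_cst (P : probability (0.-tuple R) R) (h : 0.-tuple R -> \bar R) c :
      (forall t, h t = c) -> (\int[P]_t h t = c)%E.
    move=> hc; rewrite (eq_integral (cst c)) => [|t _]; last exact: hc.
    by rewrite integral_cst// [X in (_ * X)%E](probability_setT P) mule1.
  rewrite [RHS](int_cst _ _ (f [tuple])) => [|t]; last by rewrite (tuple0 t).
  by apply: (int_cst (gamma_product a)) => x;
    apply: (int_cst (gamma_product b)) => z; congr f; exact: tuple0.
pose a' i := a (lift ord0 i); pose b' i := b (lift ord0 i).
have mfadd : measurable_fun setT
    (fun p : n.+1.-tuple R * n.+1.-tuple R => f (add_tuple p.1 p.2)).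
  exact: (measurableT_comp mf (@measurable_add_tuple n.+1)).
have mcons : measurable_fun setT (fun p : measurableTypeR R * n.-tuple R => f (pair_cons p)).
  exact: (measurableT_comp mf (@measurable_pair_cons R n)).
pose F (s : measurableTypeR R) :=
  (\int[gamma_product (fun i => a' i + b' i)%R]_t f (pair_cons (s, t)))%E.
have mF : measurable_fun setT F.
  exact: (measurable_fun_fubini_tonelli_F _ mcons (fun p => f0 _)).
rewrite [LHS]ge0_integral_gamma_productS; first last.
- by move=> x; exact: integral_ge0.
- exact: (measurable_fun_fubini_tonelli_F _ mfadd (fun p => f0 _)).
rewrite [RHS](ge0_integral_gamma_productS _ mf f0).
rewrite -[RHS](ge0_integral_gamma_law_add (a0 ord0) (b0 ord0) mF); last first.
  by move=> s; exact: integral_ge0.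
apply: eq_integral => x _.
pose g (q : (n.-tuple R * measurableTypeR R) * n.-tuple R) :=
  f (pair_cons (x + q.1.2, add_tuple q.1.1 q.2)).
have mg : measurable_fun setT g.
  apply: (measurableT_comp mf).
  apply: (@measurable_cons _ _ _ R
    (fun q : (n.-tuple R * measurableTypeR R) * n.-tuple R => x + q.1.2) n
    (fun q => add_tuple q.1.1 q.2)).
    apply: measurable_funD => //.
    by apply: (measurableT_comp measurable_snd); exact: measurable_fst.
  have mh : measurable_fun setT
      (fun q : (n.-tuple R * measurableTypeR R) * n.-tuple R => (q.1.1, q.2)).
    apply/measurable_fun_pair => //=.
    by apply: (measurableT_comp measurable_fst); exact: measurable_fst.
  exact: (measurableT_comp (@measurable_add_tuple n) mh).
(* The tail of the second tuple is integrated out, so that the exchange concerns only the tail of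
   the first and the head of the second. *)
pose G (q : n.-tuple R * measurableTypeR R) := (\int[gamma_product b']_t g (q, t))%E.
have mG : measurable_fun setT G.
  exact: (measurable_fun_fubini_tonelli_F _ mg (fun p => f0 _)).
have G0 q : (0 <= G q)%E by apply: integral_ge0 => t _; exact: f0.
transitivity (\int[gamma_product a']_s \int[gamma_law (b ord0)]_z G (s, z))%E.
  apply: eq_integral => s _.
  have mfs : measurable_fun setT (fun z => f (add_tuple (pair_cons (x, s)) z)).
    exact: (measurableT_comp mfadd (measurable_pair1 _)).
  rewrite [LHS](ge0_integral_gamma_productS _ mfs); last by move=> t; exact: f0.
  apply: eq_integral => z _; apply: eq_integral => t _.
  by rewrite add_pair_cons.
rewrite [LHS](fubini_tonelli (m1 := gamma_product a') (m2 := gamma_law (b ord0)) _ mG G0).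
apply: eq_integral => z _.
have mfxz : measurable_fun setT (fun t : n.-tuple R => f (pair_cons (x + z, t))).
  by apply: (measurableT_comp mcons); exact: measurable_pair1.
exact: (IHn a' b' _ (fun i => a0 _) (fun i => b0 _) mfxz (fun t => f0 _)).
Qed.

End tuple_convolution.

(** * Dirichlet laws carried by faces of the simplex *)

Section faces.
Context {R : realType} (n : nat) (b : 'I_n.+1 -> R).
Hypothesis b0 : forall i, 0 <= b i.
Hypothesis b_gt0 : 0 < \sum_(i < n.+1) b i.

Let T := [seq i <- enum 'I_n.+1 | 0 < b i].
Let m := (size T).-1.
Let bT (j : 'I_m.+1) := b (nth ord0 T j).

Let memT i : (i \in T) = (0 < b i).
Proof. by rewrite mem_filter mem_enum andbT. Qed.

Let uniqT : uniq T. Proof. by rewrite filter_uniq// enum_uniq. Qed.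

Let sizeT : size T = m.+1.
Proof.
rewrite /m prednK// lt0n size_eq0; apply/eqP => T0.
suff : \sum_(i < n.+1) b i = 0 by move=> b00; move: (b_gt0); rewrite b00 ltxx.
apply: big1 => i _; apply/eqP; rewrite eq_le b0 andbT leNgt.
by rewrite -memT T0.
Qed.

Let bT_gt0 j : 0 < bT j.
Proof. by rewrite /bT -memT mem_nth// sizeT. Qed.

Let big_face (S : Type) (idx : S) (op : Monoid.com_law idx) (F : 'I_n.+1 -> S) :
  \big[op/idx]_(j < m.+1) F (nth ord0 T j) = \big[op/idx]_(i | 0 < b i) F i.
Proof.
rewrite -(big_mkord xpredT (fun j => F (nth ord0 T j))) -sizeT -(big_nth ord0 xpredT F).
by rewrite big_filter big_enum_cond.
Qed.

Let sum_bT : \sum_(j < m.+1) bT j = \sum_(i < n.+1) b i.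
Proof.
rewrite [LHS](big_face _ b) [RHS](bigID (fun i => 0 < b i))/= [X in _ + X]big1 ?addr0//.
by move=> i; rewrite -leNgt => bi; apply/eqP; rewrite eq_le bi b0.
Qed.

Let face := @face_embedding R n m.+1 T.

Let tnth_face (y : m.+1.-tuple R) (j : 'I_m.+1) : tnth (face y) (nth ord0 T j) = tnth y j.
Proof.
have jT : (j < size T)%N by rewrite sizeT.
by rewrite tnth_mktuple mem_nth// index_uniq// (tnth_nth 0).
Qed.

Let tnth_face0 (y : m.+1.-tuple R) i : ~~ (0 < b i) -> tnth (face y) i = 0.
Proof. by rewrite tnth_mktuple -memT => /negbTE ->. Qed.

Let memTP i : 0 < b i -> exists j : 'I_m.+1, i = nth ord0 T j.
Proof.
rewrite -memT => iT; have iT' : (index i T < m.+1)%N by rewrite -sizeT index_mem.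
by exists (Ordinal iT'); rewrite /= nth_index.
Qed.

Let measurable_face : measurable_fun setT face.
Proof.
apply/measurable_fun_tnthP => i; have [/memTP[j ->]|bi] := boolP (0 < b i).
  rewrite (_ : _ \o _ = (@tnth m.+1 R)^~ j); first exact: measurable_tnth.
  by apply/funext => y /=; exact: tnth_face.
rewrite (_ : _ \o _ = cst 0)//.
by apply/funext => y /=; exact: tnth_face0.
Qed.

(** The coordinates outside [T] are Dirac masses at 0, exactly the value that the face embedding
    puts there. The two laws are compared on rectangles. *)
Let gamma_product_face V : measurable V ->
  gamma_product b V = gamma_product bT (face @^-1` V).
Proof.
move=> mV; rewrite -[RHS](lawE _ measurable_face).
apply: (probability_eq_on_tuple_rectangles (m := gamma_product b)
  (m' := law (gamma_product bT) measurable_face) _ mV) => U mU.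
rewrite gamma_product_rectangle// -[RHS]/(gamma_product bT (face @^-1` _)).
rewrite (bigID (fun i => 0 < b i))/=.
have gamma_law_b0 i : ~~ (0 < b i) ->
    gamma_law (b i) (U i) = dirac (0 : measurableTypeR R) (U i).
  by move=> bi; rewrite /gamma_law (negbTE bi).
(* If every side outside [T] contains 0, those factors are 1 and only the product over [T]
   remains. *)
have [U0|] := pselect (forall i, ~~ (0 < b i) -> U i 0).
  have -> : face @^-1` tuple_rectangle U =
      tuple_rectangle (fun j : 'I_m.+1 => U (nth ord0 T j)).
    apply/seteqP; split=> y /=; first by move=> Uy j; rewrite -tnth_face.
    move=> Uy i; have [/memTP[j ->]|bi] := boolP (0 < b i).
      by rewrite tnth_face.
    by rewrite tnth_face0//; exact: U0.
  rewrite [RHS](@gamma_product_rectangle R m.+1 bT (fun j => U (nth ord0 T j)))//.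
  rewrite [RHS](big_face _ (fun i => gamma_law (b i) (U i))).
  rewrite [X in (_ * X)%E]big1 ?mule1// => i bi.
  by rewrite gamma_law_b0// diracE mem_set//; exact: U0.
(* Otherwise some side outside [T] misses 0: the preimage is empty, and the Dirac factor kills the
   product. *)
move=> /existsNP[i /not_implyP[bi U0]].
rewrite (_ : face @^-1` _ = set0); last first.
  by apply/seteqP; split=> // y /= /(_ i); rewrite tnth_face0.
rewrite measure0 [X in (_ * X)%E](bigD1 i)//=.
by rewrite gamma_law_b0// diracE memNset// mul0e mule0.
Qed.

Let tuple_sum_face y : tuple_sum (face y) = tuple_sum y.
Proof.
rewrite /tuple_sum (bigID (fun i => 0 < b i))/= -big_face.
rewrite [X in _ + X]big1 ?addr0; first by apply: eq_bigr => j _; rewrite tnth_face.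
by move=> i; exact: tnth_face0.
Qed.

Let normalize_tuple_face y : normalize_tuple (face y) = face (normalize_tuple y).
Proof.
apply: eq_from_tnth => i; rewrite tnth_map tuple_sum_face.
have [/memTP[j ->]|bi] := boolP (0 < b i); last by rewrite !tnth_face0// mulr0.
by rewrite !tnth_face tnth_map.
Qed.

Let measurable_face_preimage U : measurable U -> measurable (face @^-1` U).
Proof. by move=> mU; rewrite -[X in measurable X]setTI; exact: measurable_face. Qed.

(** The face embedding preserves the sum and commutes with normalization, which reduces the claim to
    the positive parameters [bT]. *)
Let sum_normalize_face (A : set R) (U : set (n.+1.-tuple R)) :
  measurable A -> measurable U ->
  gamma_product b (@tuple_sum R n.+1 @^-1` A `&` @normalize_tuple R n.+1 @^-1` U) =
  (gamma_law (\sum_(i < n.+1) b i)%R A * dirichlet b U)%E.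
Proof.
move=> mA mU; rewrite gamma_product_face; last first.
  apply: measurableI; rewrite -[X in measurable X]setTI.
    exact: measurable_tuple_sum.
  exact: measurable_normalize_tuple.
rewrite -sum_bT /dirichlet /pushforward -gamma_product_sum_normalize//; last first.
  exact: measurable_face_preimage.
congr (gamma_product _ _); apply/seteqP; split=> y /=;
  by rewrite tuple_sum_face normalize_tuple_face.
Qed.

Lemma dirichlet_gamma_product U : measurable U ->
  dirichlet b U = gamma_product b (@normalize_tuple R n.+1 @^-1` U).
Proof.
move=> mU; have := sum_normalize_face measurableT mU.
rewrite preimage_setT setTI => ->.
by rewrite [X in (X * _)%E](_ : _ = 1%E) ?mul1e//; exact: probability_setT.
Qed.

Lemma gamma_product_indep_sum_normalize (A : set R) (U : set (n.+1.-tuple R)) :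
  measurable A -> measurable U ->
  gamma_product b (@tuple_sum R n.+1 @^-1` A `&` @normalize_tuple R n.+1 @^-1` U) =
  (gamma_law (\sum_(i < n.+1) b i)%R A *
   gamma_product b (@normalize_tuple R n.+1 @^-1` U))%E.
Proof. by move=> mA mU; rewrite sum_normalize_face// dirichlet_gamma_product. Qed.

End faces.

(** * Mixtures and convex combinations of Dirichlet laws *)

Section multinomial.
Context {F : numFieldType}.

(** The exponential series of [x 'X], truncated at degree [K]. The bound [K] matches the range
    ['I_K.+1] of the exponents in the definition of the quasi Bernoulli law. *)
Let exp_poly (K : nat) (x : F) : {poly F} := \poly_(j < K.+1) (x ^+ j / j`!%:R).

(** Up to degree [K] the truncation is invisible, and the product behaves as the exponential of the
    sum; the inductive step is the binomial theorem. *)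
Let coef_prod_exp_poly K n (x : 'I_n -> F) j : (j <= K)%N ->
  (\prod_(i < n) exp_poly K (x i))`_j = (\sum_(i < n) x i) ^+ j / j`!%:R.
Proof.
elim: n x j => [|n IHn] x j jK.
  rewrite !big_ord0 coef1 expr0n; case: j jK => [|j] _ /=; first by rewrite divr1.
  by rewrite mul0r.
(* The convolution formula and the binomial formula run through the degree of the first factor in
   opposite directions. *)
rewrite !big_ord_recl coefM exprDn mulr_suml [LHS](reindex_inj rev_ord_inj).
apply: eq_bigr => /= l _; have lj : (l <= j)%N by rewrite -ltnS.
rewrite subSS subKn// coef_poly ltnS (leq_trans (leq_subr _ _) jK).
rewrite IHn ?(leq_trans lj)// -[_ *+ 'C(j, l)]mulr_natr.
have f0 m : m`!%:R != 0 :> F by rewrite pnatr_eq0 -lt0n fact_gt0.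
have -> : 'C(j, l)%:R = j`!%:R / (l`!%:R * (j - l)`!%:R) :> F.
  by rewrite -(bin_fact lj) !natrM; field; rewrite !f0.
by field; rewrite !f0.
Qed.

(** Generating functions: expanding the product of the [exp_poly] gives one monomial for each choice
    [b] of exponents, and the coefficient of degree [K] retains those of total [K]. *)
Lemma multinomial_ffun K n (x : 'I_n -> F) :
  \sum_(b : {ffun 'I_n -> 'I_K.+1} | (\sum_(i < n) b i == K)%N)
    \prod_(i < n) (x i ^+ b i / (b i)`!%:R) =
  (\sum_(i < n) x i) ^+ K / K`!%:R.
Proof.
rewrite -(coef_prod_exp_poly _ (leqnn K)) /exp_poly.
under [in RHS]eq_bigr do rewrite poly_def.
rewrite bigA_distr_bigA coef_sum big_mkcond; apply: eq_bigr => b _ /=.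
under [in RHS]eq_bigr do rewrite -mul_polyC.
rewrite [in RHS]big_split /= -(rmorph_prod polyC) /= prodrXr coefCM coefXn eq_sym.
by case: eqP => _; rewrite ?mulr1 ?mulr0.
Qed.

End multinomial.

(** * The quasi Bernoulli mixture of the laws [D(a + b)] *)

Section dirichlet_mixture.
Context {R : realType} (n : nat).
Implicit Types (a b : 'I_n.+1 -> R) (U : set (n.+1.-tuple R)).

(** A genuine probability, unlike [dirichlet], with which it agrees on measurable sets for
    nonnegative parameters of positive sum, by [dirichlet_gamma_product]. *)
Definition dirichlet_law a : probability (n.+1.-tuple R) R :=
  law (gamma_product a) (@measurable_normalize_tuple R n.+1).

Lemma pochhammer_gt0 (p : R) k : 0 < p -> 0 < pochhammer p k.
Proof.
by move=> p0; elim: k => //= k IHk; rewrite mulr_gt0// ltr_wpDr.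
Qed.

Lemma pochhammer_ge0 (p : R) k : 0 <= p -> 0 <= pochhammer p k.
Proof.
by move=> p0; elim: k => //= k IHk; rewrite mulr_ge0// addr_ge0.
Qed.

(** Independence of the sum and the direction, known on rectangles, makes their joint law a product
    measure, to which Tonelli applies. *)
Lemma ge0_integral_sum_normalize a (f : measurableTypeR R * n.+1.-tuple R -> \bar R) :
  (forall i, 0 <= a i) -> 0 < \sum_(i < n.+1) a i ->
  measurable_fun setT f -> (forall z, 0 <= f z)%E ->
  (\int[gamma_product a]_x f (tuple_sum x, normalize_tuple x) =
   \int[gamma_law (\sum_(i < n.+1) a i)%R]_s \int[dirichlet_law a]_y f (s, y))%E.
Proof.
move=> a0 sa0 mf f0.
have mSN : measurable_fun setT
    (fun x : n.+1.-tuple R => (tuple_sum x : measurableTypeR R, normalize_tuple x)).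
  apply/measurable_fun_pair; first exact: measurable_tuple_sum.
  exact: measurable_normalize_tuple.
rewrite -(ge0_integral_law (gamma_product a) mSN mf f0).
rewrite -[RHS](fubini_tonelli1 f mf f0).
apply: eq_measure_integral => W mW _.
apply: (measure_eq_on_rectangles (m := law (gamma_product a) mSN)
    (m' := (gamma_law (\sum_(i < n.+1) a i) \x dirichlet_law a)%E) _ _ mW).
  by apply: le_lt_trans (probability_le1 _ measurableT) _; rewrite ltry.
move=> A V mA mV.
transitivity (gamma_product a (@tuple_sum R n.+1 @^-1` A `&` @normalize_tuple R n.+1 @^-1` V)).
  by [].
rewrite gamma_product_indep_sum_normalize//; symmetry.
exact: (product_measure1E (gamma_law (\sum_(i < n.+1) a i)) (dirichlet_law a) mA mV).
Qed.

Lemma integral_gamma_law_normX (p : R) k : 0 <= p ->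
  (\int[gamma_law p]_s (`|s| ^+ k)%:E = (pochhammer p k)%:E)%E.
Proof.
move=> p0.
have := gamma_law_expn k p0 (@measurable_cst _ _ _ _ setT 1%E) (fun=> lee01).
under [X in _ = X -> _]eq_integral do rewrite mul1e.
move=> <-; rewrite integral_cst// [X in (1 * X)%E](probability_setT (gamma_law _)).
by rewrite !mule1.
Qed.

Lemma dirichlet_law_mixture k a U :
  (forall i, 0 <= a i) -> 0 < \sum_(i < n.+1) a i -> measurable U ->
  ((k`!%:R / pochhammer (\sum_(i < n.+1) a i) k)%:E *
   \sum_(b : {ffun 'I_n.+1 -> 'I_k.+1} | (\sum_(i < n.+1) b i == k)%N)
     ((\prod_(i < n.+1) (pochhammer (a i) (b i) / (b i)`!%:R))%:E *
      dirichlet_law (fun i => a i + (b i)%:R)%R U))%E =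
  dirichlet_law a U.
Proof.
move=> a0 sa0 mU; pose V := @normalize_tuple R n.+1 @^-1` U.
have mV : measurable V.
  by rewrite -[X in measurable X]setTI; exact: measurable_normalize_tuple.
have mVE : measurable_fun setT (fun x => (\1_V x)%:E : \bar R).
  by apply/measurable_EFinP; exact: measurable_indic.
have V0 x : (0 <= (\1_V x)%:E :> \bar R)%E by rewrite lee_fin.
have mX (c : 'I_n.+1 -> nat) : measurable_fun setT (fun x : n.+1.-tuple R =>
    \prod_(i < n.+1) (`|tnth x i| ^+ c i / (c i)`!%:R)).
  apply: measurable_prod => i _; apply: measurable_funM => //.
  apply: measurable_funX; apply: measurableT_comp => //; exact: measurable_tnth.
have X0 (c : 'I_n.+1 -> nat) (x : n.+1.-tuple R) :
    0 <= \prod_(i < n.+1) (`|tnth x i| ^+ c i / (c i)`!%:R).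
  by apply: prodr_ge0 => i _; rewrite divr_ge0// exprn_ge0.
have mVX (c : 'I_n.+1 -> nat) : measurable_fun setT (fun x : n.+1.-tuple R =>
    ((\1_V x)%:E * (\prod_(i < n.+1) (`|tnth x i| ^+ c i / (c i)`!%:R))%:E)%E).
  by apply: emeasurable_funM => //; apply/measurable_EFinP; exact: mX.
(* Each term becomes an integral under the same law [G(a)], so that the sum over [b] can be
   performed inside the integral. *)
have step (b : {ffun 'I_n.+1 -> 'I_k.+1}) :
    ((\prod_(i < n.+1) (pochhammer (a i) (b i) / (b i)`!%:R))%:E *
      dirichlet_law (fun i => a i + (b i)%:R)%R U =
    \int[gamma_product a]_x ((\1_V x)%:E *
      (\prod_(i < n.+1) (`|tnth x i| ^+ b i / (b i)`!%:R))%:E))%E.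
  have -> : dirichlet_law (fun i => a i + (b i)%:R) U =
      (\int[gamma_product (fun i => a i + (b i)%:R)%R]_x (\1_V x)%:E)%E.
    by rewrite integral_indic// setIT.
  rewrite big_split/= mulrC EFinM -muleA gamma_product_expn//.
  rewrite -ge0_integralZl//; first last.
  - by rewrite lee_fin prodr_ge0// => i _; rewrite invr_ge0.
  - by move=> x _; rewrite mule_ge0// lee_fin prodr_ge0// => i _; rewrite exprn_ge0.
  - apply: emeasurable_funM => //; apply/measurable_EFinP.
    apply: measurable_prod => i _; apply: measurable_funX.
    by apply: measurableT_comp => //; exact: measurable_tnth.
  apply: eq_integral => x _; rewrite muleCA; congr (_ * _)%E.
  by rewrite -EFinM [in RHS]big_split/= mulrC.
rewrite (eq_bigr _ (fun c _ => step c)).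
rewrite -big_filter -ge0_integral_sum//; last first.
  by move=> b x _; rewrite mule_ge0// lee_fin.
(* The weight sees only the sum and the indicator only the direction, which is the form in which
   independence applies. *)
pose g (z : measurableTypeR R * n.+1.-tuple R) : \bar R :=
  ((\1_U z.2)%:E * ((`|z.1| ^+ k / k`!%:R)%:E))%E.
have mg : measurable_fun setT g.
  apply: emeasurable_funM.
    apply/measurable_EFinP.
    exact: (measurableT_comp (measurable_indic mU) measurable_snd).
  apply/measurable_EFinP; apply: measurable_funM => //; apply: measurable_funX.
  by apply: (measurableT_comp (@normr_measurable R setT)); exact: measurable_fst.
have g0 z : (0 <= g z)%E by rewrite mule_ge0 ?lee_fin// divr_ge0// exprn_ge0.
transitivity ((k`!%:R / pochhammer (\sum_(i < n.+1) a i) k)%:E *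
    \int[gamma_product a]_x g (tuple_sum x, normalize_tuple x))%E.
  congr (_ * _)%E; apply: gamma_product_eq_integral.
  - by apply: emeasurable_sum => c; exact: mVX.
  - apply: (measurableT_comp mg); apply/measurable_fun_pair.
      exact: measurable_tuple_sum.
    exact: measurable_normalize_tuple.
  (* On nonnegative coordinates the sum of the absolute values is the absolute value of the sum, so
     the multinomial theorem yields the [k]-th power of [tuple_sum x]. *)
  move=> x x0; rewrite big_filter -ge0_sume_distrr; last by move=> b _; rewrite lee_fin.
  rewrite sumEFin multinomial_ffun /g /=; congr (_ * (_ ^+ _ / _)%:E)%E.
  rewrite ger0_norm ?sumr_ge0//; apply: eq_bigr => i _.
  by rewrite ger0_norm.
rewrite ge0_integral_sum_normalize//.
transitivity ((k`!%:R / pochhammer (\sum_(i < n.+1) a i) k)%:E *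
  \int[gamma_law (\sum_(i < n.+1) a i)%R]_s
     ((`|s| ^+ k)%:E * ((k`!%:R)^-1%:E * dirichlet_law a U)))%E.
  congr (_ * _)%E; apply: eq_integral => s _.
  rewrite /g /= ge0_integralZr//; first last.
    by apply/measurable_EFinP; exact: measurable_indic.
  by rewrite integral_indic// setIT muleC EFinM muleA.
rewrite ge0_integralZr//; first last.
- by rewrite mule_ge0// lee_fin invr_ge0.
- apply/measurable_EFinP; apply: measurable_funX; exact: normr_measurable.
rewrite integral_gamma_law_normX ?ltW// !muleA -!EFinM.
(* The [k]-th moment of the gamma law of the sum is the Pochhammer symbol in the denominator: the
   constant of the quasi Bernoulli law is its normalization. *)
rewrite [X in X%:E](_ : _ = 1) ?mul1e//.
have := pochhammer_gt0 k sa0; set Q := pochhammer _ _ => Q0.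
by field; rewrite pnatr_eq0 -lt0n fact_gt0 gt_eqF.
Qed.

End dirichlet_mixture.

(** * Convex combinations of independent Dirichlet vectors *)

Section convex_combination.
Context {R : realType}.

Definition gamma_ratio (z : measurableTypeR R * measurableTypeR R) : R :=
  z.2 / (z.1 + z.2).

Lemma measurable_gamma_ratio : measurable_fun setT gamma_ratio.
Proof.
apply: measurable_funM; first exact: measurable_snd.
apply: (measurableT_comp measurable_invr).
by apply: measurable_funD; [exact: measurable_fst|exact: measurable_snd].
Qed.

(** For positive parameters this is the law [beta(q, p)], in reversed order: [p] belongs to the
    weight [1 - y] of the first vector and [q] to the weight [y] of the second. *)
Definition gamma_ratio_law (p q : R) : probability R R :=
  law (gamma_law p \x gamma_law q)%E measurable_gamma_ratio.

Lemma beta_lawE (p q : R) U : 0 < p -> 0 < q -> measurable U ->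
  beta_law p q U = gamma_ratio_law q p U.
Proof. exact: beta_law_gamma_law. Qed.

Definition mix_tuple n (y : R) (x d : n.-tuple R) : n.-tuple R :=
  [tuple (1 - y) * tnth x i + y * tnth d i | i < n].

Lemma measurable_mix_tuple n : measurable_fun setT
  (fun q : (n.-tuple R * R) * n.-tuple R => mix_tuple q.1.2 q.1.1 q.2).
Proof.
apply/measurable_fun_tnthP => i.
rewrite (_ : _ \o _ = fun q : (n.-tuple R * R) * n.-tuple R =>
    (1 - q.1.2) * tnth q.1.1 i + q.1.2 * tnth q.2 i); last first.
  by apply/funext => q /=; rewrite tnth_mktuple.
have m2 : measurable_fun setT (fun q : (n.-tuple R * R) * n.-tuple R => q.1.2).
  exact: (measurableT_comp measurable_snd measurable_fst).
have m1 : measurable_fun setT (fun q : (n.-tuple R * R) * n.-tuple R => tnth q.1.1 i).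
  apply: (measurableT_comp (measurable_tnth i)).
  exact: (measurableT_comp measurable_fst measurable_fst).
apply: measurable_funD; apply: measurable_funM => //.
  exact: measurable_funB.
exact: (measurableT_comp (measurable_tnth i) measurable_snd).
Qed.

(* Valid for vanishing sums too, because [0^-1 = 0]. *)
Lemma normalize_add_tuple n (u z : n.-tuple R) :
  (forall i, 0 <= tnth u i) -> (forall i, 0 <= tnth z i) ->
  normalize_tuple (add_tuple u z) =
  mix_tuple (gamma_ratio (tuple_sum u, tuple_sum z)) (normalize_tuple u) (normalize_tuple z).
Proof.
(* A nonnegative tuple is its sum times its direction even when the sum is 0, since all its
   coordinates are then 0. *)
have sumK (v : n.-tuple R) i : (forall j, 0 <= tnth v j) ->
    tuple_sum v * ((tuple_sum v)^-1 * tnth v i) = tnth v i.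
  move=> v0; have [sv0|sv0] := eqVneq (tuple_sum v) 0; last by rewrite mulVKf.
  rewrite sv0 mul0r; have /eqP := sv0.
  rewrite psumr_eq0; last by move=> j _; exact: v0.
  by move=> /allP/(_ i); rewrite mem_index_enum => /(_ isT) /eqP.
move=> u0 z0; apply: eq_from_tnth => i.
have -> : tnth (normalize_tuple (add_tuple u z)) i =
    (tuple_sum u + tuple_sum z)^-1 * (tnth u i + tnth z i).
  rewrite tnth_map tnth_mktuple; congr (_^-1 * _).
  by rewrite /tuple_sum -big_split/=; apply: eq_bigr => j _; rewrite tnth_mktuple.
rewrite tnth_mktuple !tnth_map -{1}(sumK u i u0) -{1}(sumK z i z0) /gamma_ratio /=.
have su0 : 0 <= tuple_sum u by apply: sumr_ge0 => j _; exact: u0.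
have sz0 : 0 <= tuple_sum z by apply: sumr_ge0 => j _; exact: z0.
have [S0|S0] := eqVneq (tuple_sum u + tuple_sum z) 0.
  move: (S0) => /eqP; rewrite paddr_eq0// => /andP[/eqP -> /eqP ->].
  by rewrite addr0 invr0 !mul0r !mulr0 addr0.
move: (_^-1 * tnth u i) (_^-1 * tnth z i) => u' z'.
by field.
Qed.

(** The weight is realized as a ratio of two independent gamma variables. Each of them is then
    recombined with one of the directions into a gamma tuple, and the mixture becomes the direction
    of the sum of two such tuples. *)
Lemma dirichlet_law_mix n (a b : 'I_n.+1 -> R) (U : set (n.+1.-tuple R)) :
  (forall i, 0 <= a i) -> (forall i, 0 <= b i) ->
  0 < \sum_(i < n.+1) a i -> 0 < \sum_(i < n.+1) b i -> measurable U ->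
  (\int[dirichlet_law a]_x
     \int[gamma_ratio_law (\sum_(i < n.+1) a i)%R (\sum_(i < n.+1) b i)%R]_y
       dirichlet_law b [set d | U (mix_tuple y x d)] =
   dirichlet_law (fun i => a i + b i)%R U)%E.
Proof.
move=> a0 b0 sa0 sb0 mU.
pose H (q : (n.+1.-tuple R * R) * n.+1.-tuple R) : \bar R :=
  (\1_U (mix_tuple q.1.2 q.1.1 q.2))%:E.
have mH : measurable_fun setT H.
  apply/measurable_EFinP.
  exact: (measurableT_comp (measurable_indic mU) (@measurable_mix_tuple n.+1)).
have H0 q : (0 <= H q)%E by rewrite lee_fin.
pose I (r : n.+1.-tuple R * R) : \bar R := (\int[dirichlet_law b]_d H (r, d))%E.
have mI : measurable_fun setT I by exact: (measurable_fun_fubini_tonelli_F _ mH H0).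
have I0 r : (0 <= I r)%E by apply: integral_ge0.
have IE x y : dirichlet_law b [set d | U (mix_tuple y x d)] = I (x, y).
  have mE : measurable [set d | U (mix_tuple y x d)].
    rewrite -[X in measurable X]setTI.
    exact: (measurableT_comp (@measurable_mix_tuple n.+1) (measurable_pair1 (x, y))).
  transitivity (\int[dirichlet_law b]_d (\1_[set d | U (mix_tuple y x d)] d)%:E)%E.
    by rewrite integral_indic// setIT.
  by apply: eq_integral => d _; rewrite /H /= !indicE.
under eq_integral => x _ do (under eq_integral => y _ do rewrite IE).
set p := \sum_(i < n.+1) a i; set q := \sum_(i < n.+1) b i.
(* [w] holds the sum and the direction of the first tuple; the sum [t] and the direction of the
   second are integrated out. *)
pose J (w : measurableTypeR R * n.+1.-tuple R) : \bar R :=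
  (\int[gamma_law q]_t I (w.2, gamma_ratio (w.1, t)))%E.
have mIJ : measurable_fun setT
    (fun r : (measurableTypeR R * n.+1.-tuple R) * measurableTypeR R =>
       I (r.1.2, gamma_ratio (r.1.1, r.2))).
  apply: (measurableT_comp mI); apply/measurable_fun_pair => /=.
    exact: (measurableT_comp measurable_snd measurable_fst).
  apply: (measurableT_comp measurable_gamma_ratio); apply/measurable_fun_pair => //=.
  exact: (measurableT_comp measurable_fst measurable_fst).
have mJ : measurable_fun setT J.
  exact: (measurable_fun_fubini_tonelli_F _ mIJ (fun r => I0 _)).
have J0 w : (0 <= J w)%E by apply: integral_ge0 => t _; exact: I0.
transitivity (\int[dirichlet_law a]_x \int[gamma_law p]_s J (s, x))%E.
  apply: eq_integral => x _.
  have mIx : measurable_fun setT (fun y => I (x, y)).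
    exact: (measurableT_comp mI (measurable_pair1 _)).
  rewrite (ge0_integral_law _ measurable_gamma_ratio mIx (fun y => I0 _)).
  apply: (fubini_tonelli1 _ _ (fun z => I0 _)).
  exact: (measurableT_comp mIx measurable_gamma_ratio).
(* The sum is brought outside the direction, the order in which [ge0_integral_sum_normalize] merges
   them into one tuple of law [G(a)]. *)
rewrite -[LHS](fubini_tonelli (m1 := gamma_law p) (m2 := dirichlet_law a) _ mJ J0).
rewrite -(ge0_integral_sum_normalize a0 sa0 mJ J0).
transitivity (\int[gamma_product a]_u \int[gamma_product b]_z
    H ((normalize_tuple u, gamma_ratio (tuple_sum u, tuple_sum z)), normalize_tuple z))%E.
  apply: eq_integral => u _.
  pose Hu (w : measurableTypeR R * n.+1.-tuple R) :=
    H ((normalize_tuple u, gamma_ratio (tuple_sum u, w.1)), w.2).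
  have mHu : measurable_fun setT Hu.
    apply: (measurableT_comp mH); apply/measurable_fun_pair => //=.
    apply/measurable_fun_pair => //=.
    apply: (measurableT_comp measurable_gamma_ratio).
    by apply/measurable_fun_pair => //=.
  by rewrite [RHS](ge0_integral_sum_normalize (f := Hu) b0 sb0 mHu (fun w => H0 _)).
have mNE : measurable_fun setT
    (fun w : n.+1.-tuple R => (\1_U (normalize_tuple w))%:E : \bar R).
  apply/measurable_EFinP.
  exact: (measurableT_comp (measurable_indic mU) (@measurable_normalize_tuple R n.+1)).
have NE0 (w : n.+1.-tuple R) : (0 <= (\1_U (normalize_tuple w))%:E :> \bar R)%E.
  by rewrite lee_fin.
transitivity (\int[gamma_product (fun i => a i + b i)%R]_w
    (\1_U (normalize_tuple w))%:E)%E; last first.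
  rewrite -(ge0_integral_law _ (@measurable_normalize_tuple R n.+1)
    (g := fun w => (\1_U w)%:E)) ?integral_indic ?setIT//.
    by apply/measurable_EFinP; exact: measurable_indic.
rewrite -[RHS](ge0_integral_gamma_product_add a0 b0 mNE NE0).
have mN2 : measurable_fun setT (fun r : n.+1.-tuple R * n.+1.-tuple R =>
    (\1_U (normalize_tuple (add_tuple r.1 r.2)))%:E : \bar R).
  exact: (measurableT_comp mNE (@measurable_add_tuple R n.+1)).
have mH2 : measurable_fun setT (fun r : n.+1.-tuple R * n.+1.-tuple R =>
    H ((normalize_tuple r.1, gamma_ratio (tuple_sum r.1, tuple_sum r.2)),
       normalize_tuple r.2)).
  have m1 := measurableT_comp (@measurable_normalize_tuple R n.+1)
    (@measurable_fst _ _ (n.+1.-tuple R) (n.+1.-tuple R)).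
  have m2 := measurableT_comp (@measurable_normalize_tuple R n.+1)
    (@measurable_snd _ _ (n.+1.-tuple R) (n.+1.-tuple R)).
  have m3 := measurableT_comp (@measurable_tuple_sum R n.+1)
    (@measurable_fst _ _ (n.+1.-tuple R) (n.+1.-tuple R)).
  have m4 := measurableT_comp (@measurable_tuple_sum R n.+1)
    (@measurable_snd _ _ (n.+1.-tuple R) (n.+1.-tuple R)).
  apply: (measurableT_comp mH); apply/measurable_fun_pair => //=.
  apply/measurable_fun_pair => //=.
  apply: (measurableT_comp measurable_gamma_ratio).
  by apply/measurable_fun_pair => //=.
(* [normalize_add_tuple] holds for nonnegative tuples only, hence the restriction to the nonnegative
   orthant, for [u] and then for [z]. *)
apply: gamma_product_eq_integral.
- exact: (measurable_fun_fubini_tonelli_F _ mH2 (fun r => H0 _)).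
- exact: (measurable_fun_fubini_tonelli_F _ mN2 (fun r => NE0 _)).
move=> u u0; apply: gamma_product_eq_integral.
- exact: (measurableT_comp mH2 (measurable_pair1 _)).
- exact: (measurableT_comp mN2 (measurable_pair1 _)).
by move=> z z0; rewrite normalize_add_tuple.
Qed.

End convex_combination.

(** * Random probabilities *)

Section independence.
Local Open Scope ereal_scope.
Context dS d1 d2 d3 (S : measurableType dS) (T1 : measurableType d1)
  (T2 : measurableType d2) (T3 : measurableType d3) (R : realType).
Variables (P : probability S R) (Z1 : S -> T1) (Z2 : S -> T2) (Z3 : S -> T3).
Hypotheses (mZ1 : measurable_fun setT Z1) (mZ2 : measurable_fun setT Z2)
  (mZ3 : measurable_fun setT Z3).
Hypothesis indep : forall U1 U2 U3, measurable U1 -> measurable U2 -> measurable U3 ->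
  P (Z1 @^-1` U1 `&` Z2 @^-1` U2 `&` Z3 @^-1` U3) =
  P (Z1 @^-1` U1) * P (Z2 @^-1` U2) * P (Z3 @^-1` U3).

Let Z13 s := (Z1 s, Z3 s).

Let mZ13 : measurable_fun setT Z13. Proof. exact/measurable_fun_pair. Qed.

Let preimageZ d (T : measurableType d) (Z : S -> T) (mZ : measurable_fun setT Z) U :
  measurable U -> measurable (Z @^-1` U).
Proof. by move=> mU; rewrite -[X in measurable X]setTI; exact: mZ. Qed.

Let P_lty A : measurable A -> P A < +oo.
Proof. by move=> mA; rewrite (le_lt_trans (probability_le1 _ mA))// ltry. Qed.

(** For a fixed [C] both sides are finite measures in [E]: the image of [P] restricted to the event
    [Z2] in [C], and a multiple of a product measure. Threefold independence equates them on
    rectangles. *)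
Let indep13 E C : measurable E -> measurable C ->
  P (Z13 @^-1` E `&` Z2 @^-1` C) = (law P mZ1 \x law P mZ3) E * P (Z2 @^-1` C).
Proof.
move=> mE mC; have mZC := preimageZ mZ2 mC.
have PCfin : P (Z2 @^-1` C) \is a fin_num by exact: fin_num_measure.
pose c : {nonneg R} := NngNum (fine_ge0 (measure_ge0 P (Z2 @^-1` C))).
pose m := pushforward_measure (mrestr P mZC) mZ13.
have mE' A : m A = P (Z13 @^-1` A `&` Z2 @^-1` C) by [].
rewrite -mE' (measure_eq_on_rectangles (m := m)
  (m' := mscale c (law P mZ1 \x law P mZ3)%E) _ _ mE).
- rewrite muleC -[X in (X * _)%E](fineK PCfin); reflexivity.
- rewrite mE'; apply: P_lty; apply: measurableI => //.
  exact: preimageZ.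
move=> A B mA mB; rewrite mE'.
transitivity (P (Z2 @^-1` C) * (P (Z1 @^-1` A) * P (Z3 @^-1` B))); last first.
  rewrite -[X in (X * _)%E](fineK PCfin).
  by congr (_ * _); symmetry; exact: (product_measure1E (law P mZ1) (law P mZ3) mA mB).
rewrite muleCA muleA -indep//; congr (P _).
by apply/seteqP; split=> s /= [[? ?] ?].
Qed.

(** The variable [Z2], later the quasi Bernoulli vector, is placed innermost, so that its law can be
    decomposed as a mixture with the other two values frozen. *)
Lemma independent_law W : measurable W ->
  P [set s | W ((Z1 s, Z3 s), Z2 s)] =
  \int[law P mZ1]_x \int[law P mZ3]_y law P mZ2 [set z | W ((x, y), z)].
Proof.
move=> mW.
have mZ132 : measurable_fun setT (fun s => (Z13 s, Z2 s)) by exact/measurable_fun_pair.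
transitivity (law P mZ132 W) => //.
rewrite (measure_eq_on_rectangles (m := law P mZ132)
  (m' := ((law P mZ1 \x law P mZ3) \x law P mZ2)%E) _ _ mW).
- have mxs := measurable_fun_xsection (law P mZ2) mW.
  transitivity (\int[law P mZ1 \x law P mZ3]_r law P mZ2 (xsection W r)) => //.
  have xs0 r : 0 <= law P mZ2 (xsection W r) by exact: measure_ge0.
  apply: (etrans (fubini_tonelli1 (m1 := law P mZ1) (m2 := law P mZ3) _ mxs xs0)).
  apply: eq_integral => x _; apply: eq_integral => y _; congr (law _ _ _).
  by apply/seteqP; split=> z /=; rewrite /xsection /= ?inE.
- by apply: P_lty; exact: preimageZ.
- move=> E C mE mC.
  transitivity (P (Z13 @^-1` E `&` Z2 @^-1` C)) => //.
  rewrite indep13//; symmetry.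
  exact: (product_measure1E (law P mZ1 \x law P mZ3) (law P mZ2) mE mC).
Qed.

End independence.

(** * Values on a partition and the conclusion for processes *)

Section partition_vectors.
Context dO (Omega : measurableType dO) (R : realType) n (A : 'I_n.+1 -> set Omega).
Hypothesis pA : measurable_partition A.

(** The partition vector is factored through a map of the random probability alone; once this map is
    known to be measurable, independence of [X], [B], [Y] passes to the vectors. *)
Definition probability_vector (mu : pprobability Omega R) : n.+1.-tuple R :=
  [tuple fine ((mu : probability Omega R) (A i)) | i < n.+1].

Lemma measurable_probability_vector : measurable_fun setT probability_vector.
Proof.
case: pA => mA _ _; apply/measurable_fun_tnthP => i.
rewrite (_ : _ \o _ = fun mu : pprobability Omega R =>
    fine ((mu : probability Omega R) (A i))); last first.
  by apply/funext => mu /=; rewrite tnth_mktuple.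
apply: (measurableT_comp (@fine_measurable R setT measurableT)).
(* The identity of [pprobability] is viewed as a probability kernel, and measurability of a kernel
   on a fixed set is measurability of the evaluation. *)
have mid : measurable_fun setT (@id (pprobability Omega R)) by exact: measurable_id.
exact: (measurable_kernel (kprobability mid) (A i) (mA i)).
Qed.

Lemma sum_partition (alpha : {measure set Omega -> \bar R}) (a : R) :
  alpha [set: Omega] = a%:E ->
  \sum_(i < n.+1) fine (alpha (A i)) = a.
Proof.
case: pA => mA tA UA alphaT; apply: EFin_inj; rewrite -alphaT -sumEFin.
have Afin i : alpha (A i) \is a fin_num.
  rewrite ge0_fin_numE//; apply: (@le_lt_trans _ _ (alpha setT)).
    by apply: le_measure; rewrite ?inE.
  by rewrite alphaT ltry.
under eq_bigr do rewrite fineK//.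
rewrite -measure_bigsetU_ord//; congr (alpha _).
rewrite -UA -bigcup_seq; apply/seteqP; split=> w [i _ Aiw]; exists i => //=.
by rewrite mem_index_enum.
Qed.

End partition_vectors.

Lemma ge0_integral_linear_combination d (T : measurableType d) (R : realType)
    (m : {measure set T -> \bar R}) (I : Type) (r : seq I) (c : R) (w : I -> R)
    (f : I -> T -> \bar R) :
  0 <= c -> (forall i, 0 <= w i) -> (forall i, measurable_fun setT (f i)) ->
  (forall i t, 0 <= f i t)%E ->
  (\int[m]_t (c%:E * \sum_(i <- r) (w i)%:E * f i t) =
   c%:E * \sum_(i <- r) (w i)%:E * \int[m]_t f i t)%E.
Proof.
move=> c0 w0 mf f0.
have mwf i : measurable_fun setT (fun t => (w i)%:E * f i t)%E by exact: measurable_funeM.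
have wf0 i t : (0 <= (w i)%:E * f i t)%E by rewrite mule_ge0// lee_fin.
rewrite ge0_integralZl//.
- rewrite ge0_integral_sum//; congr (_ * _)%E; apply: eq_bigr => i _.
  by rewrite ge0_integralZl// lee_fin.
- by apply: emeasurable_sum => i; exact: mwf.
- by move=> t _; apply: sume_ge0 => i _; exact: wf0.
Qed.

(** As [k > 0], no admissible [b] is identically 0, so each [D(b)] is the direction law of a gamma
    product, zero entries included. *)
Lemma quasi_bernoulli_dirichlet_law (R : realType) n k (a : 'I_n.+1 -> R)
    (U : set (n.+1.-tuple R)) : (0 < k)%N -> measurable U ->
  quasi_bernoulli k a U =
  ((k`!%:R / pochhammer (\sum_(i < n.+1) a i) k)%:E *
   \sum_(b : {ffun 'I_n.+1 -> 'I_k.+1} | (\sum_(i < n.+1) b i == k)%N)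
     ((\prod_(i < n.+1) (pochhammer (a i) (b i) / (b i)`!%:R))%:E *
      dirichlet_law (fun i => (b i)%:R) U))%E.
Proof.
move=> k0 mU; rewrite /quasi_bernoulli; congr (_ * _)%E.
apply: eq_bigr => b /eqP bk; congr (_ * _)%E.
rewrite dirichlet_gamma_product//.
by rewrite -natr_sum bk ltr0n.
Qed.

(** The left side is linear in [Q]. Each component [D(b)] is turned into [D(a + b)] by
    [dirichlet_law_mix], and [dirichlet_law_mixture] sums the results to [D(a)]. *)
Lemma quasi_bernoulli_convex_combination (R : realType) n k (a : 'I_n.+1 -> R)
    (Q : probability (n.+1.-tuple R) R) (U : set (n.+1.-tuple R)) :
  (0 < k)%N -> (forall i, 0 <= a i) -> 0 < \sum_(i < n.+1) a i ->
  (forall V, measurable V -> Q V = quasi_bernoulli k a V) -> measurable U ->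
  (\int[dirichlet_law a]_x \int[gamma_ratio_law (\sum_(i < n.+1) a i)%R k%:R]_y
     Q [set d | U (mix_tuple y x d)] = dirichlet_law a U)%E.
Proof.
move=> k0 a0 sa0 QE mU.
pose K (b : {ffun 'I_n.+1 -> 'I_k.+1}) (r : n.+1.-tuple R * R) : \bar R :=
  dirichlet_law (fun i => (b i)%:R) [set d | U (mix_tuple r.2 r.1 d)].
pose w (b : {ffun 'I_n.+1 -> 'I_k.+1}) : R :=
  \prod_(i < n.+1) (pochhammer (a i) (b i) / (b i)`!%:R).
pose c : R := k`!%:R / pochhammer (\sum_(i < n.+1) a i) k.
pose L := [seq b : {ffun 'I_n.+1 -> 'I_k.+1} <- index_enum {ffun 'I_n.+1 -> 'I_k.+1} |
  (\sum_(i < n.+1) b i == k)%N].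
have w0 b : 0 <= w b.
  by apply: prodr_ge0 => i _; rewrite divr_ge0// pochhammer_ge0.
have c0 : 0 <= c by rewrite divr_ge0// ltW// pochhammer_gt0.
have mW : measurable [set q : (n.+1.-tuple R * R) * n.+1.-tuple R |
    U (mix_tuple q.1.2 q.1.1 q.2)].
  by rewrite -[X in measurable X]setTI; exact: measurable_mix_tuple.
have mK b : measurable_fun setT (K b).
  have := measurable_fun_xsection (dirichlet_law (fun i => (b i)%:R)) mW.
  apply: eq_measurable_fun => r _; congr (dirichlet_law _ _).
  by apply/seteqP; split=> d; rewrite /xsection /= ?inE.
have K0 b r : (0 <= K b r)%E by exact: measure_ge0.
have QK x y : Q [set d | U (mix_tuple y x d)] = (c%:E * \sum_(b <- L) (w b)%:E * K b (x, y))%E.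
  rewrite QE; last first.
    rewrite -[X in measurable X]setTI.
    exact: (measurableT_comp (@measurable_mix_tuple R n.+1) (measurable_pair1 (x, y))).
  rewrite quasi_bernoulli_dirichlet_law//; last first.
    rewrite -[X in measurable X]setTI.
    exact: (measurableT_comp (@measurable_mix_tuple R n.+1) (measurable_pair1 (x, y))).
  by rewrite /L big_filter.
under eq_integral => x _ do (under eq_integral => y _ do rewrite QK).
set beta := gamma_ratio_law _ _.
have mKx b x : measurable_fun setT (fun y => K b (x, y)).
  exact: (measurableT_comp (mK b) (measurable_pair1 _)).
have mIK b : measurable_fun setT (fun x => \int[beta]_y K b (x, y))%E.
  exact: (measurable_fun_fubini_tonelli_F _ (mK b) (K0 b)).
have IK0 b x : (0 <= \int[beta]_y K b (x, y))%E by exact: integral_ge0.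
under eq_integral => x _ do rewrite (ge0_integral_linear_combination beta L c0 w0
  (fun b => mKx b x) (fun b y => K0 b (x, y))).
rewrite (ge0_integral_linear_combination (dirichlet_law a) L c0 w0 mIK IK0).
rewrite -[RHS](dirichlet_law_mixture k a0 sa0 mU); congr (_ * _)%E.
rewrite big_filter; apply: eq_bigr => b /eqP bk; congr (_ * _)%E.
(* All the [b] have total [k], so the law of the weight in [dirichlet_law_mix] is the same [beta]
   for every term. *)
have sb : \sum_(i < n.+1) (b i)%:R = k%:R :> R by rewrite -natr_sum bk.
have b0 i : 0 <= (b i)%:R :> R by [].
have sb0 : 0 < \sum_(i < n.+1) (b i)%:R :> R by rewrite sb ltr0n.
have := dirichlet_law_mix a0 b0 sa0 sb0 mU; rewrite sb; exact.
Qed.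

Theorem mainTheorem7 (R : realType)
    (dO : measure_display) (Omega : measurableType dO)
    (alpha : {measure set Omega -> \bar R}) (a : R)
    (alphaT : alpha [set: Omega] = a%:E) (a_gt0 : 0 < a)
    (k : nat) (k_gt0 : (0 < k)%N)
    (dS : measure_display) (S : measurableType dS) (P : probability S R)
    (X B : {RV P >-> pprobability Omega R}) (Y : {RV P >-> R})
    (lawX : dirichlet_process alpha X)
    (lawB : quasi_bernoulli_process k alpha B)
    (lawY : has_law P Y (beta_law k%:R a))
    (indep : independent3 X B Y) :
  eq_in_law P (random_value X) (random_mixture Y X B).
Proof.
move=> n A pA U mU.
pose p i := fine (alpha (A i)).
have p0 i : 0 <= p i by rewrite fine_ge0.
have sp : \sum_(i < n.+1) p i = a by exact: sum_partition.
have sp0 : 0 < \sum_(i < n.+1) p i by rewrite sp.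
have mv : measurable_fun setT (@probability_vector _ Omega R n A).
  exact: measurable_probability_vector.
have mX : measurable_fun setT (fun s => probability_vector A (X s)).
  exact: (measurableT_comp mv (measurable_funPT X)).
have mB : measurable_fun setT (fun s => probability_vector A (B s)).
  exact: (measurableT_comp mv (measurable_funPT B)).
have mY : measurable_fun setT Y by exact: measurable_funPT Y.
have mv' V : measurable V -> measurable (@probability_vector _ Omega R n A @^-1` V).
  by move=> mV; rewrite -[X in measurable X]setTI; exact: (mv measurableT V mV).
have DX V : measurable V -> law P mX V = dirichlet_law p V.
  move=> mV; rewrite -[RHS]/(gamma_product p _) -dirichlet_gamma_product//.
  exact: (lawX _ _ pA V mV).
(* The total mass of the cells is [a] for every partition, so the law of [Y] fits each of them. *)
have BY V : measurable V -> law P mY V = gamma_ratio_law (\sum_(i < n.+1) p i) k%:R V.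
  move=> mV; rewrite sp -beta_lawE ?ltr0n//.
  exact: (lawY V mV).
have QB V : measurable V -> law P mB V = quasi_bernoulli k p V.
  by move=> mV; exact: (lawB _ _ pA V mV).
transitivity (dirichlet_law p U); first exact: (DX U mU).
rewrite -(quasi_bernoulli_convex_combination k_gt0 p0 sp0 QB mU).
pose W := [set q : (n.+1.-tuple R * R) * n.+1.-tuple R | U (mix_tuple q.1.2 q.1.1 q.2)].
have mW : measurable W.
  by rewrite -[X in measurable X]setTI; exact: measurable_mix_tuple.
have ind U1 U2 U3 : measurable U1 -> measurable U2 -> measurable U3 ->
    (P ((fun s => probability_vector A (X s)) @^-1` U1 `&`
        (fun s => probability_vector A (B s)) @^-1` U2 `&` Y @^-1` U3) =
     P ((fun s => probability_vector A (X s)) @^-1` U1) *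
     P ((fun s => probability_vector A (B s)) @^-1` U2) * P (Y @^-1` U3))%E.
  by move=> mU1 mU2 mU3; exact: (indep _ _ _ (mv' _ mU1) (mv' _ mU2) mU3).
(* The partition vector of the mixture is [mix_tuple] of the two partition vectors, so its law is an
   iterated integral by independence. *)
transitivity (P [set s | W ((probability_vector A (X s), Y s), probability_vector A (B s))]);
    last first.
  congr (P _); rewrite /W /=; apply/seteqP.
  have E s : mix_tuple (Y s) (probability_vector A (X s)) (probability_vector A (B s)) =
      partition_vector (random_mixture Y X B) A s.
    by apply: eq_from_tnth => i; rewrite !tnth_mktuple.
  by split=> s /=; rewrite E.
rewrite (independent_law mX mB mY ind mW); symmetry.
apply: (etrans (eq_measure_integral (dirichlet_law p) _)); first by move=> V mV _; exact: DX.
apply: eq_integral => x _.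
by apply: eq_measure_integral => V mV _; exact: BY.
Qed.
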